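(* Let $F=f+\psi-g$ on $\mathbb{R}^n$ satisfy the standing assumptions (A1)–(A4) listed in the context, with positive integers $p,q$. Let $(x_k)_{k\ge0}$ be a sequence generated by the HO-DC algorithm (defined in the context), assumed to be bounded, and let $\Omega(x_0)$ be its set of limit points. Assume also that $F$ satisfies the Kurdyka-Lojasiewicz (KL) property on $\Omega(x_0)$. Then the whole sequence $(x_k)_{k\ge0}$ converges to a stationary point of $F$, i.e. to a point $x^*$ with $0\in\partial F(x^* )$.
   Context: Problem: minimize $F(x)=f(x)+\psi(x)-g(x)$ over $x\in\mathbb{R}^n$ (Euclidean norm $\|\cdot\|$), with $F=+\infty$ outside $\text{dom}\,F=\text{dom}\,\psi$. Standing assumptions, with $p,q$ positive integers: (A1) $f$ is convex and $p$ times continuously differentiable on $\text{dom}\,\psi$ (derivatives are understood for a function defined on an open convex set containing $\text{dom}\,\psi$), and its $p$-th derivative is Lipschitz on $\text{dom}\,\psi$ with constant $L_p^f>0$: $\|D^pf(x)-D^pf(y)\|\le L_p^f\|x-y\|$ for all $x,y\in\text{dom}\,\psi$. (A2) $g$ is convex and $q$ times continuously differentiable on $\text{dom}\,\psi$ (same convention), and its $q$-th derivative is Lipschitz on $\text{dom}\,\psi$ with constant $L_q^g>0$. (A3) $\psi:\mathbb{R}^n\to\mathbb{R}\cup\{+\infty\}$ is proper, lower semicontinuous and convex, with closed convex domain $\text{dom}\,\psi$. (A4) The problem has a solution, and hence $\inf_{x\in\text{dom}\,\psi}F(x)\ge F^*>-\infty$ for a constant $F^*$. The norm of a symmetric $p$-linear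 form is $\|D^p\phi\|=\max\{|D^p\phi[h]^p|:\|h\|\le 1\}$, where $D^p\phi[h]^p$ denotes evaluation with all arguments equal to $h$. Taylor approximation: $T_p^{\phi}(y;x)=\phi(x)+\sum_{i=1}^p\frac1{i!}D^i\phi(x)[y-x]^i$. Model: for $x\in\text{dom}\,\psi$ and constants $M_p>L_p^f$, $M_q>L_q^g$ (two separate constants, even if $p=q$), $$m_p^q(y;x)=T_p^f(y;x)+\frac{M_p}{(p+1)!}\|y-x\|^{p+1}+\psi(y)-T_q^g(y;x)+\frac{M_q}{(q+1)!}\|y-x\|^{q+1}.$$ HO-DC algorithm: choose $x_0\in\text{dom}\,\psi$, $M_p>L_p^f$, $M_q>L_q^g$. For each $k\ge 0$, $x_{k+1}$ is any stationary point of $y\mapsto m_p^q(y;x_k)$, i.e. $0\in\partial m_p^q(x_{k+1};x_k)$ (limiting subdifferential with respect to the first argument), satisfying $m_p^q(x_{k+1};x_k)\le m_p^q(x_k;x_k)=F(x_k)$. A sequence $(x_k)_{k\ge 0}$ is generated by HO-DC if it arises this way. Here $\partial$ is the limiting (Mordukhovich) subdifferential; in particular $\partial F(x)=\nabla f(x)-\nabla g(x)+\partial\psi(x)$ for $x\in\text{dom}\,\psi$. Put $S_F(x)=\text{dist}(0,\partial F(x))$ (equal to $+\infty$ if $\partial F(x)=\emptyset$). KL property: a proper lower semicontinuous function $\phi$ satisfies the KL property on a compact connected set $\Omega\subseteq\text{dom}\,\phi$ on which $\phi$ takes a constant value $\phi_*$ if there exist $\delta,\epsilon>0$ and a concave function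 $\kappa:[0,\epsilon]\to\mathbb{R}_+$ with $\kappa(0)=0$, differentiable on $(0,\epsilon)$ with $\kappa'>0$, such that $$\kappa'(\phi(x)-\phi_* )\cdot S_\phi(x)\ge1\quad\text{for all }x\text{ with }\text{dist}(x,\Omega)\le\delta,\ \phi_*<\phi(x)<\phi_*+\epsilon.$$ In particular, assuming the KL property of $F$ on $\Omega(x_0)$ includes that $\Omega(x_0)$ is compact and connected and that $F$ is constant on it. *)

(* Defs.v *)
From mathcomp Require Import all_boot all_order all_algebra.
From mathcomp Require Import all_classical all_reals all_analysis.

Set Implicit Arguments.
Unset Strict Implicit.
Unset Printing Implicit Defensive.

Import Order.TTheory GRing.Theory Num.Theory.
Import numFieldNormedType.Exports.

Local Open Scope classical_set_scope.
Local Open Scope ring_scope.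

Section Euclidean.
Context {R : realType} {n : nat}.
Local Notation E := 'rV[R]_n.

Definition dotv (u v : E) : R := \sum_(i < n) u 0 i * v 0 i.

(* The library norm of ['rV[R]_n] is the max norm; topology, convergence and
   differentiability do not depend on this choice, but every quantity that does
   (Lipschitz constants, distances, regularization) is stated with [enorm]. *)
Definition enorm (u : E) : R := Num.sqrt (dotv u u).

Definition edist_set (x : E) (A : set E) : \bar R :=
  ereal_inf [set (enorm (x - y))%:E | y in A].

Definition edom (phi : E -> \bar R) : set E := [set x | (phi x < +oo)%E].

Definition eproper (phi : E -> \bar R) : Prop :=
  (forall x, phi x != -oo%E) /\ edom phi !=set0.

(* With the library convention [0 * +oo = 0], the endpoints t = 0, 1 are
   harmless. *)
Definition econvex (phi : E -> \bar R) : Prop :=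
  forall (x y : E) (t : R), 0 <= t -> t <= 1 ->
    (phi (t *: x + (1 - t) *: y)%R <= t%:E * phi x + (1 - t)%:E * phi y)%E.

(* The derivative of phi is of class C^k' iff x |-> D phi(x)[v] is for every v,
   and D phi(x)[v] = 'D_v phi x where phi is differentiable. *)
Fixpoint Ck (U : set E) (k : nat) (phi : E -> R) : Prop :=
  if k is k'.+1 then
    (forall x, U x -> differentiable phi x) /\ (forall v, Ck U k' ('D_v phi))
  else {in U, continuous phi}.

(* D^i phi(x)[h]^i: the direction h is fixed, so iterating the directional
   derivative along h evaluates the i-th derivative with all arguments h. *)
Definition Dpow (phi : E -> R) (i : nat) (x h : E) : R :=
  iter i (fun u : E -> R => 'D_h u) phi x.

(* The norm of a symmetric multilinear form, given by its diagonal
   h |-> A[h]^i. *)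
Definition form_norm (A : E -> R) : \bar R :=
  ereal_sup [set `|A h|%:E | h in [set h | enorm h <= 1]].

Definition smooth_convex (p : nat) (L : R) (D : set E) (phi : E -> R) : Prop :=
  [/\ convex_function D phi,
      exists U : set E, [/\ open U, convex_set U, D `<=` U & Ck U p phi],
      0 < L &
      forall x y, D x -> D y ->
        (form_norm (fun h => Dpow phi p x h - Dpow phi p y h)%R
           <= (L * enorm (x - y))%:E)%E].

Definition taylor (p : nat) (phi : E -> R) (y x : E) : R :=
  phi x + \sum_(1 <= i < p.+1) (i`!)%:R^-1 * Dpow phi i x (y - x).

Definition objective (f g : E -> R) (psi : E -> \bar R) (x : E) : \bar R :=
  ((f x)%:E + psi x - (g x)%:E)%E.

Definition model (p q : nat) (Mp Mq : R) (f g : E -> R) (psi : E -> \bar R)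
    (y x : E) : \bar R :=
  ((taylor p f y x)%:E + (Mp / (p.+1)`!%:R * enorm (y - x) ^+ p.+1)%:E
   + psi y - (taylor q g y x)%:E
   + (Mq / (q.+1)`!%:R * enorm (y - x) ^+ q.+1)%:E)%E.

(* phi y >= phi x + <v, y - x> + o(|y - x|) as y -> x. *)
Definition frechet_subdiff (phi : E -> \bar R) (x : E) : set E :=
  [set v | phi x \is a fin_num /\
    forall e : R, 0 < e -> \forall y \near x,
      (phi x + (dotv v (y - x) - e * enorm (y - x))%:E <= phi y)%E].

Definition limiting_subdiff (phi : E -> \bar R) (x : E) : set E :=
  [set v | phi x \is a fin_num /\
    exists u w : nat -> E,
      [/\ u @ \oo --> x, phi \o u @ \oo --> phi x,
          forall k, frechet_subdiff phi (u k) (w k) & w @ \oo --> v]].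

Definition stationary (phi : E -> \bar R) (x : E) : Prop :=
  limiting_subdiff phi x 0.

Definition slope (phi : E -> \bar R) (x : E) : \bar R :=
  edist_set 0 (limiting_subdiff phi x).

Definition KL_on (phi : E -> \bar R) (Om : set E) : Prop :=
  [/\ compact Om, connected Om, Om `<=` edom phi &
    exists phis : R, (forall x, Om x -> phi x = phis%:E) /\
    exists (delta eps : R) (kappa : R -> R),
      [/\ 0 < delta /\ 0 < eps,
          convex_function `[0, eps] (fun t : R^o => - kappa t),
          kappa 0 = 0 /\ (forall t, 0 <= t <= eps -> 0 <= kappa t),
          forall t, 0 < t < eps -> derivable kappa t 1 /\ 0 < derive1 kappa t &
          forall x : E, (edist_set x Om <= delta%:E)%E ->
            (phis%:E < phi x)%E -> (phi x < (phis + eps)%:E)%E ->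
            (1 <= (derive1 kappa (fine (phi x) - phis))%:E * slope phi x)%E]].

Definition HO_DC (p q : nat) (Lf Lg : R) (f g : E -> R) (psi : E -> \bar R)
    (x : nat -> E) : Prop :=
  exists Mp Mq : R, [/\ Lf < Mp, Lg < Mq, edom psi (x 0%N) &
    forall k,
      stationary (fun y => model p q Mp Mq f g psi y (x k)) (x k.+1) /\
      (model p q Mp Mq f g psi (x k.+1) (x k)
         <= model p q Mp Mq f g psi (x k) (x k))%E].

End Euclidean.

(* Main.v *)
(** Write [d_k = |x_{k+1} - x_k|] and [r = min(p, q)].  Comparing the model with
    [F] through the Taylor remainders of [f] and [g] gives the descent
    [a d_k^(r+1) <= F(x_k) - F(x_{k+1})].  Stationarity of the model gives a
    Frechet subgradient [w_k] of [F] at [x_{k+1}] with [|w_k| <= b d_k^r], because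
    the gradient of a Taylor polynomial approximates the gradient to order [p]
    (resp. [q]) by the Lipschitz condition on the highest derivative.  The bound
    on that condition is only given for the diagonal of the multilinear form; it
    is polarized by reading off the linear coefficient of [s |-> A[h + s v]^p].
    Convexity of [psi] and lower semicontinuity force [F(x_k)] to tend to the value
    of [F] on the cluster set.  With [Delta_k] the decrement of
    [kappa(F(x_{k+1}) - lim F(x_j))], the KL inequality and the concavity of [kappa] yield
    [a d_{k+1}^(r+1) <= b Delta_k d_k^r], hence [d_{k+1} <= d_k / 2 + C Delta_k];
    so the steps are summable, and the subgradient inequality of [psi] passes to
    the limit. *)

Require Import Defs.
From mathcomp Require Import all_boot all_order all_algebra.
From mathcomp Require Import all_classical all_reals all_analysis.
From mathcomp Require Import ring lra.

Import Order.TTheory GRing.Theory Num.Theory.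
Import numFieldNormedType.Exports.

Set Implicit Arguments.
Unset Strict Implicit.
Unset Printing Implicit Defensive.

Local Open Scope classical_set_scope.
Local Open Scope ring_scope.

Lemma cvg_sumr {R : realType} (T : Type) (F : set_system T) {FF : Filter F}
    (I : Type) (r : seq I) (f : I -> T -> R) (l : I -> R) :
  (forall i, f i t @[t --> F] --> l i) ->
  \sum_(i <- r) f i t @[t --> F] --> \sum_(i <- r) l i.
Proof.
by move=> fl; apply: (cvg_big (fun xy => @add_continuous R^o xy)) => i _.
Qed.

(** * Euclidean inner product and norm on row vectors *)

Section Euclidean.
Context {R : realType} {n : nat}.
Implicit Types (u v w : 'rV[R]_n) (c : R).

Lemma dotvC u v : dotv u v = dotv v u.
Proof. by apply: eq_bigr => i _; rewrite mulrC. Qed.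

Lemma dotvDl u v w : dotv (u + v) w = dotv u w + dotv v w.
Proof. by rewrite -big_split; apply: eq_bigr => i _; rewrite mxE mulrDl. Qed.

Lemma dotvZl c u v : dotv (c *: u) v = c * dotv u v.
Proof. by rewrite mulr_sumr; apply: eq_bigr => i _; rewrite mxE mulrA. Qed.

Lemma dotvDr u v w : dotv u (v + w) = dotv u v + dotv u w.
Proof. by rewrite dotvC dotvDl !(dotvC u). Qed.

Lemma dotvZr c u v : dotv u (c *: v) = c * dotv u v.
Proof. by rewrite dotvC dotvZl dotvC. Qed.

Lemma dotvNl u v : dotv (- u) v = - dotv u v.
Proof. by rewrite -scaleN1r dotvZl mulN1r. Qed.

Lemma dotvNr u v : dotv u (- v) = - dotv u v.
Proof. by rewrite dotvC dotvNl dotvC. Qed.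

Lemma dotv0l u : dotv 0 u = 0.
Proof. by rewrite -(scale0r u) dotvZl mul0r. Qed.

Lemma dotv0r u : dotv u 0 = 0.
Proof. by rewrite dotvC dotv0l. Qed.

Lemma dotv_delta u (j : 'I_n) : dotv u (delta_mx 0 j) = u 0 j.
Proof.
rewrite /dotv (bigD1 j)//= big1 ?addr0 => [|i ij].
  by rewrite mxE !eqxx mulr1.
by rewrite mxE (negbTE ij) andbF mulr0.
Qed.

Lemma dotv_ge0 u : 0 <= dotv u u.
Proof. by apply: sumr_ge0 => i _; rewrite -expr2 sqr_ge0. Qed.

Lemma enorm_ge0 u : 0 <= enorm u.
Proof. exact: sqrtr_ge0. Qed.
#[local] Hint Resolve enorm_ge0 : core.

Lemma sqr_enorm u : enorm u ^+ 2 = dotv u u.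
Proof. by rewrite sqr_sqrtr ?dotv_ge0. Qed.

Lemma enormZ c u : enorm (c *: u) = `|c| * enorm u.
Proof.
rewrite /enorm dotvZl dotvZr mulrA -expr2 sqrtrM ?sqr_ge0//.
by rewrite sqrtr_sqr.
Qed.

Lemma enorm0 : enorm (0 : 'rV[R]_n) = 0.
Proof. by rewrite -(scale0r 0) enormZ normr0 mul0r. Qed.

Lemma enormN u : enorm (- u) = enorm u.
Proof. by rewrite -scaleN1r enormZ normrN1 mul1r. Qed.

Lemma ler_coord_enorm u (j : 'I_n) : `|u 0 j| <= enorm u.
Proof.
rewrite -sqrtr_sqr ler_wsqrtr// /dotv (bigD1 j)//= -expr2 lerDl.
by apply: sumr_ge0 => i _; rewrite -expr2 sqr_ge0.
Qed.

Lemma enorm_eq0 u : enorm u = 0 -> u = 0.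
Proof.
move=> u0; apply/rowP => j; rewrite mxE; apply/eqP.
by rewrite -normr_le0 -u0 ler_coord_enorm.
Qed.

Lemma normr_le_enorm u : `|u| <= enorm u.
Proof.
rewrite [`|u|]mx_normrE; apply: bigmax_le => // -[i j] _ /=.
by rewrite ord1 ler_coord_enorm.
Qed.

(** Cauchy-Schwarz: the squared norm of [enorm v *: u - enorm u *: v] is $2|u||v|(|u||v|-\langle
    u,v\rangle)$, and the positive factor $|u||v|$ is cancelled. *)
Lemma dotv_le_enorm u v : dotv u v <= enorm u * enorm v.
Proof.
have [/enorm_eq0 ->|u0] := eqVneq (enorm u) 0; first by rewrite dotv0l enorm0 mul0r.
have [/enorm_eq0 ->|v0] := eqVneq (enorm v) 0; first by rewrite dotv0r enorm0 mulr0.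
have up : 0 < enorm u by rewrite lt_def u0 /=.
have vp : 0 < enorm v by rewrite lt_def v0 /=.
have := dotv_ge0 (enorm v *: u - enorm u *: v).
rewrite dotvDl !dotvDr dotvNl !dotvNr dotvNl !dotvZl !dotvZr -!sqr_enorm (dotvC v u).
move=> H; rewrite -subr_ge0 -(pmulr_rge0 _ (mulr_gt0 up vp)); nra.
Qed.

Lemma normr_dotv_le u v : `|dotv u v| <= enorm u * enorm v.
Proof.
rewrite ler_norml dotv_le_enorm andbT lerNl -dotvNl -(enormN u).
exact: dotv_le_enorm.
Qed.

Lemma enormD_le u v : enorm (u + v) <= enorm u + enorm v.
Proof.
rewrite -ler_sqr ?nnegrE ?addr_ge0// sqr_enorm dotvDl !dotvDr sqrrD -!sqr_enorm.
have := dotv_le_enorm u v; rewrite (dotvC v u); nra.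
Qed.

Lemma enorm_sum_le (I : Type) (s : seq I) (F : I -> 'rV[R]_n) :
  enorm (\sum_(i <- s) F i) <= \sum_(i <- s) enorm (F i).
Proof.
elim/big_ind2 : _ => //; first by rewrite enorm0.
by move=> a x b y ax b_y; rewrite (le_trans (enormD_le _ _))// lerD.
Qed.

(** Reduces norm estimates and convergence to single coordinates; with [normr_le_enorm] it ties the
    Euclidean norm to the library topology. *)
Lemma enorm_le_sum_coord u : enorm u <= \sum_(j < n) `|u 0 j|.
Proof.
have uS : u = \sum_(j < n) u 0 j *: delta_mx 0 j by rewrite -row_sum_delta.
rewrite {1}uS (le_trans (enorm_sum_le _ _))// ler_sum// => j _.
rewrite enormZ ler_piMr// /enorm dotv_delta mxE !eqxx.
by rewrite sqrtr1.
Qed.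

Lemma cvg_dotv (T : Type) (F : set_system T) {FF : Filter F}
    (a b : T -> 'rV[R]_n) (x y : 'rV[R]_n) :
  a @ F --> x -> b @ F --> y -> (fun t => dotv (a t) (b t)) @ F --> dotv x y.
Proof.
move=> ax b_y; rewrite /dotv; apply: cvg_sumr => j.
apply: cvgM.
- exact: (cvg_comp _ _ ax (@coord_continuous R 1 n 0 j x)).
- exact: (cvg_comp _ _ b_y (@coord_continuous R 1 n 0 j y)).
Qed.

Lemma cvg_enorm (T : Type) (F : set_system T) {FF : Filter F}
    (a : T -> 'rV[R]_n) (x : 'rV[R]_n) :
  a @ F --> x -> (fun t => enorm (a t)) @ F --> enorm x.
Proof.
move=> ax; rewrite /enorm.
exact: (cvg_comp _ _ (cvg_dotv ax ax) (@sqrt_continuous R (dotv x x))).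
Qed.

Lemma cvg_row (T : Type) (F : set_system T) {FF : Filter F}
    (a : T -> 'rV[R]_n) (x : 'rV[R]_n) :
  (forall j, a t 0 j @[t --> F] --> x 0 j) -> a @ F --> x.
Proof.
move=> ax; apply/cvgrPdist_lt => e e0.
have : \sum_(j <- enum 'I_n) `|x 0 j - a t 0 j| @[t --> F] -->
    \sum_(j <- enum 'I_n) `|x 0 j - x 0 j|.
  apply: cvg_sumr => j; apply: cvg_norm; apply: cvgB; [exact: cvg_cst|exact: ax].
rewrite big1 => [|j _]; last by rewrite subrr normr0.
move=> /cvgrPdist_lt /(_ _ e0); apply: filterS => t.
rewrite sub0r normrN ger0_norm ?sumr_ge0// => /le_lt_trans; apply.
rewrite (le_trans (normr_le_enorm _))// (le_trans (enorm_le_sum_coord _))//.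
by rewrite big_enum/=; apply: ler_sum => j _; rewrite !mxE.
Qed.

End Euclidean.

(** * One-variable mean value, Taylor and polynomial estimates *)

Section OneVariable.
Context {R : realType}.
Implicit Types (u du : R -> R) (K t s : R) (m p : nat).

Lemma MVT0 (f df : R -> R) s : 0 <= s ->
  (forall t, 0 <= t <= s -> is_derive t (1 : R) f (df t)) ->
  exists2 t, 0 <= t <= s & f s - f 0 = df t * s.
Proof.
move=> s0 fD.
have [t] : exists2 t, t \in `[0, s]%R & f s - f 0 = df t * (s - 0).
  apply: (MVT_segment (df := df) s0).
    move=> t; rewrite in_itv/= => /andP[t0 ts]; apply: fD.
    by rewrite (ltW t0) (ltW ts).
  apply: derivable_within_continuous => t; rewrite in_itv/= => ts.
  by have [] := fD t ts.
by rewrite in_itv/= subr0 => ts E; exists t.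
Qed.

(** Replaces integration of the bound on [du]: for [c = 1] and [c = -1] the function $K
    s^{m+1}/(m+1) - c\,u(s)$ has a nonnegative derivative, so the mean value theorem bounds both
    signs of the increment. *)
Lemma increment_bound u du K m :
  (forall t, 0 <= t <= 1 -> is_derive t (1 : R) u (du t)) ->
  (forall t, 0 <= t <= 1 -> `|du t| <= K * t ^+ m) ->
  forall t, 0 <= t <= 1 -> `|u t - u 0| <= K / m.+1%:R * t ^+ m.+1.
Proof.
move=> uD duK.
have key (c : R) : `|c| = 1 -> forall t, 0 <= t <= 1 ->
    c * (u t - u 0) <= K / m.+1%:R * t ^+ m.+1.
  move=> c1 t /andP[t0 t1].
  pose w (s : R) := K / m.+1%:R * s ^+ m.+1 - c * u s.
  have wD s : 0 <= s <= 1 -> is_derive s (1 : R) w (K * s ^+ m - c * du s).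
    move=> /uD us.
    have -> : w = (K / m.+1%:R) *: (@id R) ^+ m.+1 - c *: u.
      by apply/funext => x; rewrite /w !fctE.
    apply: is_derive_eq.
    rewrite /GRing.scale/=.
    by field; rewrite nat1r pnatr_eq0.
  have [z /andP[z0 zt] E] : exists2 z, 0 <= z <= t &
      w t - w 0 = (K * z ^+ m - c * du z) * t.
    apply: (MVT0 (df := fun z => K * z ^+ m - c * du z) t0) => z /andP[z0 zt].
    by apply: wD; rewrite z0 (le_trans zt).
  have : 0 <= w t - w 0.
    rewrite E mulr_ge0// subr_ge0.
    rewrite (le_trans (ler_norm _))// normrM c1 mul1r duK// z0 (le_trans zt)//.
  rewrite /w [0 ^+ m.+1]exprS mul0r mulr0 sub0r mulrBr opprK.
  by move: (K / _ * _) (c * u t) (c * u 0) => A B D; lra.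
move=> t t01; rewrite ler_norml.
have := key 1 (normr1 _) t t01; have := key (-1) (normrN1 _) t t01.
rewrite mul1r mulN1r => H1 H2; rewrite H2 andbT lerNl; exact: H1.
Qed.

(** Here [u i] stands for the i-th derivative. The remainder [w] vanishes at 0 and its derivative is
    the remainder of the shifted family, so each induction step integrates once and raises the power
    by one. *)
Lemma taylor_remainder p (u : nat -> R -> R) K :
  (forall i t, (i < p)%N -> 0 <= t <= 1 -> is_derive t (1 : R) (u i) (u i.+1 t)) ->
  (forall t, 0 <= t <= 1 -> `|u p t - u p 0| <= K * t) ->
  forall t, 0 <= t <= 1 ->
  `|u 0%N t - \sum_(i < p.+1) i`!%:R^-1 * u i 0 * t ^+ i|
    <= K / p.+1`!%:R * t ^+ p.+1.
Proof.
elim: p u => [|p IH] u uD uK t t01.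
  have -> : K / 1`!%:R = K by rewrite divr1.
  by rewrite big_ord1 fact0 invr1 mul1r expr0 expr1 mulr1 uK.
have {}IH := IH (fun i => u i.+1) (fun i t ip => uD i.+1 t ip) uK.
pose w (s : R) := u 0%N s - \sum_(i < p.+2) i`!%:R^-1 * u i 0 * s ^+ i.
have w0 : w 0 = 0.
  rewrite /w big_ord_recl big1 ?fact0 ?expr0; first by lra.
  by move=> i _; rewrite exprS mul0r mulr0.
have := @increment_bound w
  (fun s => u 1%N s - \sum_(i < p.+1) i`!%:R^-1 * u i.+1 0 * s ^+ i)
  (K / p.+1`!%:R) p.+1 _ IH t t01.
rewrite w0 subr0 => H; rewrite (le_trans (H _)) //.
  move=> s s01; have us := uD 0%N s isT s01.
  have -> : w = u 0%N - \sum_(i < p.+2) (i`!%:R^-1 * u i 0) *: (@id R) ^+ i.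
    apply/funext => x; rewrite /w !fctE fct_sumE; congr (_ - _).
    by apply: eq_bigr => i _; rewrite !fctE.
  have Ps : is_derive s 1 (\sum_(i < p.+2) (i`!%:R^-1 * u i 0) *: (@id R) ^+ i)
      (\sum_(i < p.+2) (i`!%:R^-1 * u i 0) *: ((i%:R * s ^+ i.-1) *: 1)).
    by apply: is_derive_sum => i.
  apply: is_derive_eq; congr (_ - _).
  rewrite big_ord_recl /= mul0r scale0r scaler0 add0r; apply: eq_bigr => i _.
  rewrite /GRing.scale/= /bump/= add1n factS natrM invfM.
  by field; rewrite nat1r !pnatr_eq0 -!lt0n fact_gt0.
rewrite [p.+2`!]factS natrM invfM le_eqVlt; apply/orP; left; apply/eqP; ring.
Qed.

(* Passing from [q(s)] to [q(s) - 2^p q(s/2)] kills the leading coefficient and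
   multiplies the linear one by the nonzero constant [1 - 2^(p-1)]. *)
Lemma linear_coef_bound p : (0 < p)%N -> exists2 C : R, 0 <= C &
  forall (a : nat -> R) K,
    (forall s, `|s| <= 1 -> `|\sum_(m < p.+1) a m * s ^+ m| <= K) ->
    `|a 1%N| <= C * K.
Proof.
case: p => // p _; elim: p => [|p [C C0 IH]].
  exists 2 => // a K aK.
  have := aK 1; have := aK 0; rewrite !big_ord_recl !big_ord0 normr0 normr1 /=.
  rewrite /bump/= !expr0 !expr1 !mulr1 mulr0 !addr0 addn0 => /(_ ler01) H0 /(_ (lexx _)) H1.
  have -> : a 1%N = (a 0%N + a 1%N) - a 0%N by ring.
  by rewrite (le_trans (ler_normB _ _))//; lra.
(* The degree is now [p.+2], so the linear coefficient is multiplied by [1 - 2 ^+ p.+1], of absolute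
   value [e]; the new polynomial is bounded by [(1 + 2 ^+ p.+2) * K]. *)
pose e : R := 2 ^+ p.+1 - 1.
have e0 : 0 < e by rewrite subr_gt0 exprn_egt1// ltr1n.
exists (C * (1 + 2 ^+ p.+2) / e).
  by rewrite divr_ge0 ?(ltW e0)// mulr_ge0// addr_ge0// exprn_ge0.
move=> a K aK.
pose a' m := a m * (1 - 2 ^+ p.+2 / 2 ^+ m).
have := IH a' ((1 + 2 ^+ p.+2) * K) _.
have a'1 : `|a' 1%N| = e * `|a 1%N|.
  rewrite /a' normrM mulrC; congr (_ * _).
  rewrite -[RHS]gtr0_norm// distrC /e; congr `|_|.
  by rewrite expr1 [2 ^+ p.+2]exprS; field.
rewrite a'1 => H.
rewrite -(@ler_pM2l _ e)// (le_trans (H _)) //; last first.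
  by rewrite le_eqVlt; apply/orP; left; apply/eqP; field; rewrite gt_eqF.
move=> s s1.
have -> : \sum_(m < p.+2) a' m * s ^+ m =
    \sum_(m < p.+3) a m * s ^+ m - 2 ^+ p.+2 * \sum_(m < p.+3) a m * (s / 2) ^+ m.
  rewrite mulr_sumr -sumrB [RHS]big_ord_recr/=.
  rewrite [X in _ + X](_ : _ = 0) ?addr0.
    apply: eq_bigr => i _; rewrite /a' exprMn exprVn; ring.
  rewrite exprMn exprVn; field.
  by rewrite expf_neq0.
rewrite (le_trans (ler_normB _ _))// mulrDl mul1r lerD ?aK//.
rewrite normrM ger0_norm ?exprn_ge0// ler_pM2l ?exprn_gt0// aK//.
by rewrite normrM normfV normr_nat ler_pdivrMr// (le_trans s1)// mul1r ler1n.
Qed.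

End OneVariable.

(** * Iterated directional derivatives *)

Section IteratedDerivatives.
Context {R : realType} {n : nat}.
Local Notation E := 'rV[R]_n.
Variables (U : set E) (oU : open U).
Implicit Types (phi : E -> R) (x z h v w : E) (s c : R) (i k : nat).

Lemma is_derive_line phi z v (t : R) : derivable phi (z + t *: v) v ->
  is_derive t (1 : R) (fun t => phi (z + t *: v)) ('D_v phi (z + t *: v)).
Proof.
have E : (fun h : R => h^-1 *: (((fun t => phi (z + t *: v)) \o shift t) (h *: (1:R))
    - phi (z + t *: v))) =
  (fun h : R => h^-1 *: ((phi \o shift (z + t *: v)) (h *: v) - phi (z + t *: v))).
  apply/funext => h /=; congr (_ *: (phi _ - _)).
  by rewrite [h *: 1]mulr1 scalerDl addrCA.
by move=> D; split; rewrite /derivable /derive E.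
Qed.

Lemma near_open z : U z -> \forall y \near z, U y.
Proof. by move=> Uz; apply: open_nbhs_nbhs; split. Qed.

Lemma derive_eq_on (a b : E -> R) z v :
  (forall y, U y -> a y = b y) -> U z -> 'D_v a z = 'D_v b z.
Proof.
move=> ab Uz; apply: near_eq_derive.
by apply: filterS (near_open Uz) => y /ab.
Qed.

Lemma Dpow_eq_on (a b : E -> R) i z h :
  (forall y, U y -> a y = b y) -> U z -> Dpow a i z h = Dpow b i z h.
Proof.
move=> ab; elim: i z => [|i IH] z Uz; first exact: ab.
exact: derive_eq_on.
Qed.

Lemma DpowSr phi i x h : Dpow phi i.+1 x h = Dpow ('D_h phi) i x h.
Proof. by rewrite /Dpow iterSr. Qed.

Lemma Ck_continuous k phi z : Ck U k phi -> U z -> {for z, continuous phi}.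
Proof.
case: k => [|k] /= => [+ Uz|[+ _] Uz]; first by apply; rewrite inE.
by move=> /(_ z Uz); exact: differentiable_continuous.
Qed.

Lemma CkW k phi : Ck U k.+1 phi -> Ck U k phi.
Proof.
elim: k phi => [|k IH] phi.
  by move=> H y; rewrite inE => Uy; exact: Ck_continuous H Uy.
by move=> [dphi Dphi]; split => // v; exact: IH.
Qed.

Lemma Ck_le i k phi : (i <= k)%N -> Ck U k phi -> Ck U i phi.
Proof.
elim: k => [|k IH]; first by rewrite leqn0 => /eqP ->.
by rewrite leq_eqVlt => /predU1P[-> //|ik /CkW]; exact: IH.
Qed.

Lemma Ck_iter i k phi h : Ck U (i + k) phi -> Ck U k (iter i (fun u => 'D_h u) phi).
Proof.
elim: i phi => [//|i IH] phi [_ H]; rewrite iterSr; exact: (IH _ (H h)).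
Qed.

Lemma deriveDdir phi z h v c : differentiable phi z ->
  'D_(h + c *: v) phi z = 'D_h phi z + c * 'D_v phi z.
Proof. by move=> d; rewrite !deriveE// linearD linearZ. Qed.

Lemma Dpow_comb (a b : E -> R) c i x h : Ck U i a -> Ck U i b -> U x ->
  Dpow (fun y => a y + c * b y) i x h = Dpow a i x h + c * Dpow b i x h.
Proof.
elim: i x => [//|i IH] x Ca Cb Ux.
rewrite /Dpow iterS (@derive_eq_on _ (iter i (fun u => 'D_h u) a +
   c *: iter i (fun u => 'D_h u) b))//; last first.
  by move=> y Uy; rewrite -/(Dpow _ i y h) IH//; exact: CkW.
have [Da _] : Ck U 1 (iter i (fun u => 'D_h u) a) by apply: Ck_iter; rewrite addn1.
have [Db _] : Ck U 1 (iter i (fun u => 'D_h u) b) by apply: Ck_iter; rewrite addn1.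
have da : derivable (iter i (fun u => 'D_h u) a) x h.
  by apply: diff_derivable; exact: Da.
have db : derivable (iter i (fun u => 'D_h u) b) x h.
  by apply: diff_derivable; exact: Db.
have dcb : derivable (c *: iter i (fun u => 'D_h u) b) x h by exact: derivableZ.
have E : 'D_h (c *: iter i (fun u => 'D_h u) b) x
    = c *: 'D_h (iter i (fun u => 'D_h u) b) x by exact: deriveZ.
by rewrite (deriveD da dcb) E.
Qed.

Lemma Dpow_derive_comb phi i x h v w c : Ck U i.+1 phi -> U x ->
  Dpow ('D_(h + c *: v) phi) i x w = Dpow ('D_h phi) i x w + c * Dpow ('D_v phi) i x w.
Proof.
move=> [dphi Dphi] Ux; rewrite -(Dpow_comb c w (Dphi h) (Dphi v) Ux).
by apply: Dpow_eq_on => // y Uy; rewrite deriveDdir//; exact: dphi.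
Qed.

Lemma linear_coord (l : E -> R) : (forall h v c, l (h + c *: v) = l h + c * l v) ->
  forall h, l h = dotv (\row_j l (delta_mx 0 j)) h.
Proof.
move=> ll h.
have l0 : l 0 = 0 by have := ll 0 0 (-1); rewrite scaler0 addr0 mulN1r subrr.
have lD a b : l (a + b) = l a + l b by rewrite -(scale1r b) ll scale1r mul1r.
have lZ c a : l (c *: a) = c * l a by rewrite -[c *: a]add0r ll l0 add0r.
rewrite {1}(row_sum_delta h) (big_morph l lD l0); apply: eq_bigr => j _.
by rewrite lZ !mxE mulrC.
Qed.

(** Frees one slot of the multilinear form: [Dpow] sees only the diagonal, but differentiating first
    along [h] keeps [h] in a slot of its own, where the dependence is linear. *)
Lemma Dpow_derive_dotv phi i x h w : Ck U i.+1 phi -> U x ->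
  Dpow ('D_h phi) i x w = dotv (\row_j Dpow ('D_(delta_mx 0 j) phi) i x w) h.
Proof.
move=> Cphi Ux.
apply: (@linear_coord (fun h => Dpow ('D_h phi) i x w)) => a b c.
exact: Dpow_derive_comb.
Qed.

Lemma Dpow_homog phi i x h c : Ck U i phi -> U x ->
  Dpow phi i x (c *: h) = c ^+ i * Dpow phi i x h.
Proof.
elim: i phi => [|i IH] phi Cphi Ux; first by rewrite mul1r.
have [_ Dphi] := Cphi; rewrite !DpowSr (IH _ (Dphi _) Ux).
by rewrite !Dpow_derive_dotv// dotvZr exprSr mulrA.
Qed.

Lemma continuous_Dpow phi i x : Ck U i phi -> U x ->
  continuous (Dpow phi i x : E -> R).
Proof.
elim: i phi => [|i IH] phi Cphi Ux z.
  by rewrite (_ : Dpow phi 0 x = cst (phi x))//; exact: cst_continuous.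
have -> : Dpow phi i.+1 x =
    (fun w => \sum_j Dpow ('D_(delta_mx 0 j) phi) i x w * w 0 j).
  apply/funext => w; rewrite DpowSr Dpow_derive_dotv//.
  by apply: eq_bigr => j _; rewrite mxE.
apply: (@cvg_sumr R E (nbhs z) _) => j.
apply: cvgM; last exact: coord_continuous.
have [_ Dphi] := Cphi; exact: IH (Dphi _) Ux _.
Qed.

Let secdiff phi x h v s := phi (x + s *: h + s *: v) - phi (x + s *: h)
  - (phi (x + s *: v) - phi x).

(** The mean value theorem is applied twice, first along [h] to the difference in [v], then along
    [v] to the derivative ['D_h phi]. *)
Lemma second_difference phi x h v s : Ck U 2 phi -> 0 <= s ->
  (forall a b, 0 <= a <= s -> 0 <= b <= s -> U (x + a *: h + b *: v)) ->
  exists a b, [/\ 0 <= a <= s, 0 <= b <= s &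
    secdiff phi x h v s = 'D_v ('D_h phi) (x + a *: h + b *: v) * s * s].
Proof.
move=> [dphi Dphi] s0 US.
have s00 : 0 <= (0 : R) <= s by rewrite lexx.
have s0s : 0 <= s <= s by rewrite s0 lexx.
pose p a := phi (x + s *: v + a *: h) - phi (x + a *: h).
pose dp a := 'D_h phi (x + s *: v + a *: h) - 'D_h phi (x + a *: h).
have [a as_ Ea] : exists2 t, 0 <= t <= s & p s - p 0 = dp t * s.
  apply: (MVT0 (f := p) (df := dp) s0) => t ts.
   apply: is_deriveB; apply: is_derive_line; apply: diff_derivable; apply: dphi.
    by rewrite addrAC; exact: US.
  by have := US _ _ ts s00; rewrite scale0r addr0.
pose q b := 'D_h phi (x + a *: h + b *: v).
pose dq b := 'D_v ('D_h phi) (x + a *: h + b *: v).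
have [b bs Eb] : exists2 t, 0 <= t <= s & q s - q 0 = dq t * s.
  apply: (MVT0 (f := q) (df := dq) s0) => t ts.
   apply: is_derive_line; apply: diff_derivable.
  by have [Dd _] := Dphi h; apply: Dd; exact: US.
exists a, b; split => //.
rewrite -/(dq b) -Eb /q scale0r addr0 (addrAC x (a *: h)) -/(dp a) -Ea.
by rewrite /p scale0r !addr0 /secdiff (addrAC x (s *: v)).
Qed.

Lemma dist_le_split (p q r1 r2 e : R) : p = q -> `|r1 - p| < e / 2 ->
  `|r2 - q| < e / 2 -> `|r1 - r2| <= e.
Proof.
move=> -> H1 H2; have -> : r1 - r2 = (r1 - q) - (r2 - q) by ring.
by rewrite (le_trans (ler_normB _ _))//; lra.
Qed.

(** Schwarz's theorem: the second difference is unchanged when [h] and [v] are swapped, so the two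
    mixed derivatives agree at a pair of points arbitrarily close to [x], and continuity
    concludes. *)
Lemma derive_sym phi x h v : Ck U 2 phi -> U x ->
  'D_v ('D_h phi) x = 'D_h ('D_v phi) x.
Proof.
move=> C2 Ux; apply/eqP; rewrite -subr_eq0 -normr_le0.
apply/ler_addgt0Pr => e e0; rewrite add0r.
have e20 : 0 < e / 2 by rewrite divr_gt0.
have cont a b : \forall y \near x, `|'D_b ('D_a phi) x - 'D_b ('D_a phi) y| < e / 2.
  have [_ /(_ a) [_ /(_ b) C0]] := C2.
  by have /cvgrPdist_lt := C0 x (mem_set Ux); apply.
have /nbhs_ballP[r /= r0 rU] : \forall y \near x, [/\ U y,
    `|'D_v ('D_h phi) x - 'D_v ('D_h phi) y| < e / 2 &
    `|'D_h ('D_v phi) x - 'D_h ('D_v phi) y| < e / 2].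
  by apply: filterS3 (near_open Ux) (cont h v) (cont v h) => y.
(* With this size the whole parallelogram spanned by [s *: h] and [s *: v] stays in the ball of
   radius [r]; the added 1 avoids division by zero. *)
pose s := r / 2 / (`|h| + `|v| + 1).
have hv0 : 0 < `|h| + `|v| + 1 by rewrite ltr_wpDl// addr_ge0.
have s0 : 0 < s by rewrite !divr_gt0.
have inb (p q : E) a b : (`|p| + `|q| = `|h| + `|v|) ->
    0 <= a <= s -> 0 <= b <= s -> ball x r (x + a *: p + b *: q).
  move=> pq /andP[a0 as_] /andP[b0 bs].
  rewrite -ball_normE /ball_/= -addrA opprD addNKr normrN.
  rewrite (le_lt_trans (ler_normD _ _))// !normrZ !ger0_norm//.
  have : a * `|p| + b * `|q| <= s * (`|p| + `|q|).
    by rewrite mulrDr lerD// ler_wpM2r.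
  move/le_lt_trans; apply; rewrite pq.
  have -> : r = s * (`|h| + `|v| + 1) * 2 by rewrite /s; field; rewrite gt_eqF.
  have : 0 <= s * (`|h| + `|v|) by rewrite mulr_ge0 ?addr_ge0// ltW.
  by rewrite [s * (_ + 1)]mulrDr mulr1; move: s0; lra.
have hv : `|h| + `|v| = `|h| + `|v| by [].
have vh : `|v| + `|h| = `|h| + `|v| by rewrite addrC.
have [a [b [as_ bs E1]]] : exists a b, [/\ 0 <= a <= s, 0 <= b <= s &
    secdiff phi x h v s = 'D_v ('D_h phi) (x + a *: h + b *: v) * s * s].
  apply: second_difference => //; first exact: ltW.
  by move=> a b as_ bs; have [] := rU _ (inb h v a b hv as_ bs).
have [c [d [cs ds E2]]] : exists a b, [/\ 0 <= a <= s, 0 <= b <= s &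
    secdiff phi x v h s = 'D_h ('D_v phi) (x + a *: v + b *: h) * s * s].
  apply: second_difference => //; first exact: ltW.
  by move=> c d cs ds; have [] := rU _ (inb v h c d vh cs ds).
have E3 : secdiff phi x h v s = secdiff phi x v h s.
  by rewrite /secdiff (addrAC x (s *: v)); ring.
have sI : s != 0 by rewrite gt_eqF.
have := etrans (etrans (esym E1) E3) E2.
move=> /(mulIf sI) /(mulIf sI).
have [_ + _] := rU _ (inb h v a b hv as_ bs).
have [_ _ +] := rU _ (inb v h c d vh cs ds).
move=> H2 H1 pq.
exact: (dist_le_split pq H1 H2).
Qed.

(** Polarization: the linear coefficient along a line recovers the mixed value
    $D^i\phi(x)[v,h,\dots,h]$ from the diagonal. The factor [i] counts the slots that [v] can
    occupy, which are interchangeable by [derive_sym]. *)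
Lemma Dpow_line phi i x h v : Ck U i phi -> U x -> exists a : nat -> R,
  (forall s, Dpow phi i x (h + s *: v) = \sum_(m < i.+1) a m * s ^+ m) /\
  a 1%N = i%:R * Dpow ('D_v phi) i.-1 x h.
Proof.
elim: i phi => [|i IH] phi Cphi Ux.
  exists (fun m => if m is 0%N then phi x else 0); split; last by rewrite mul0r.
  by move=> s; rewrite big_ord1 mulr1.
have [dphi Dphi] := Cphi.
have [ah [ahE ah1]] := IH _ (Dphi h) Ux.
have [av [avE av1]] := IH _ (Dphi v) Ux.
(* Splitting one slot as $h + s v$ adds the coefficients for [h] to those for [v] shifted by one
   degree. The guard is needed because [ah] is unconstrained beyond degree [i]. *)
exists (fun m => (if (m < i.+1)%N then ah m else 0) + (if m is m'.+1 then av m' else 0)).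
split => [s|].
  rewrite DpowSr Dpow_derive_comb// ahE avE.
  under [RHS]eq_bigr do rewrite mulrDl.
  rewrite big_split/=; congr (_ + _).
    rewrite [RHS]big_ord_recr/= ltnn mul0r addr0.
    by apply: eq_bigr => m _; rewrite ltn_ord.
  rewrite [RHS]big_ord_recl/= mul0r add0r mulr_sumr; apply: eq_bigr => m _.
  by rewrite /bump/= add1n exprS; ring.
have av0 : av 0%N = Dpow ('D_v phi) i x h.
  have := avE 0; rewrite scale0r addr0 big_ord_recl big1 ?addr0 ?mulr1 // => m _.
  by rewrite expr0n/= mulr0.
rewrite /= av0; case: i {IH} Cphi ah1 Dphi {ahE avE av1 av0} => [|i] Cphi ah1 Dphi.
  by rewrite ltnn add0r mul1r.
have E : Dpow ('D_v ('D_h phi)) i x h = Dpow ('D_h ('D_v phi)) i x h.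
  apply: Dpow_eq_on Ux => y Uy; apply: derive_sym Uy.
  exact: Ck_le Cphi.
rewrite ltnS ltnS/= ah1 E -DpowSr.
by rewrite -[i.+2]addn1 natrD mulrDl mul1r.
Qed.

End IteratedDerivatives.

(** * Taylor models of functions with Lipschitz derivatives *)

Section TaylorModel.
Context {R : realType} {n : nat}.
Local Notation E := 'rV[R]_n.
Implicit Types (phi : E -> R) (x y z h v : E) (D U : set E) (p i : nat).

Definition egrad phi z : E := \row_j 'D_(delta_mx 0 j) phi z.

(** The gradient in [z] of [taylor p phi z x], written as the row of Taylor polynomials of degree
    [p - 1] of the partial derivatives; [is_derive_taylor] justifies this form. *)
Definition taylor_grad p phi x z : E :=
  \row_j \sum_(i < p) i`!%:R^-1 * Dpow ('D_(delta_mx 0 j) phi) i x (z - x).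

Lemma convex_set_line D x y (t : R) : convex_set D -> D x -> D y ->
  0 <= t <= 1 -> D (x + t *: (y - x)).
Proof.
move=> cD Dx Dy /andP[t0 t1].
have /set_mem := cD y x (Itv01 t0 t1) (mem_set Dy) (mem_set Dx).
suff -> : conv (Itv01 t0 t1) (y : convex_lmodType E) x = x + t *: (y - x) by [].
apply: (etrans (_ : _ = t *: y + (1 - t) *: x)) => //.
by rewrite scalerBl scale1r scalerBr addrCA.
Qed.

Lemma derive_egrad phi z h : differentiable phi z ->
  'D_h phi z = dotv (egrad phi z) h.
Proof.
move=> dz; apply: (@linear_coord _ _ (fun h => 'D_h phi z)) => a b c.
exact: deriveDdir.
Qed.

Lemma taylorE p phi y x :
  taylor p phi y x = \sum_(i < p.+1) i`!%:R^-1 * Dpow phi i x (y - x).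
Proof.
rewrite /taylor big_ord_recl/= fact0 invr1 mul1r; congr (_ + _).
by rewrite big_add1/= big_mkord.
Qed.

Lemma is_derive_sumr m (f : 'I_m -> R -> R) (d : 'I_m -> R) (t : R) :
  (forall j, is_derive t (1 : R) (f j) (d j)) ->
  is_derive t (1 : R) (fun s => \sum_(j < m) f j s) (\sum_(j < m) d j).
Proof.
move=> fd; have := is_derive_sum fd.
by congr is_derive; apply/funext => s; rewrite fct_sumE.
Qed.

Lemma is_derive_polynomial0 (a : nat -> R) m :
  is_derive (0 : R) (1 : R) (fun t => \sum_(i < m.+1) a i * t ^+ i)
    (if m is 0%N then 0 else a 1%N).
Proof.
have H : is_derive (0 : R) (1 : R) (fun t => \sum_(i < m.+1) a i * t ^+ i)
    (\sum_(i < m.+1) a i * (i%:R * 0 ^+ i.-1)).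
  apply: is_derive_sumr => i.
  have -> : (fun t => a i * t ^+ i) = a i *: (@id R) ^+ i by apply/funext => t; rewrite !fctE.
  by apply: is_derive_eq; rewrite /GRing.scale/= mulr1.
apply: is_derive_eq H _; case: m => [|m].
  by rewrite big_ord1 mul0r mulr0.
rewrite 2!big_ord_recl big1 /= ?mul0r ?mulr0 ?add0r ?addr0 ?expr0 ?mulr1//.
by move=> i _; rewrite exprS mul0r !mulr0.
Qed.

Lemma continuous_subr x : continuous (fun z => z - x).
Proof.
move=> z; apply: (@cvgB _ _ _ (nbhs z) _ id (cst x) z x).
  exact: cvg_id.
exact: cvg_cst.
Qed.

Section Open.
Variables (U : set E) (oU : open U).

Lemma continuous_egrad p phi z : (0 < p)%N -> Ck U p phi -> U z ->
  {for z, continuous (egrad phi)}.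
Proof.
case: p => [//|p] _ [_ Dphi] Uz.
apply: (@cvg_row R n E (nbhs z) _) => j.
rewrite mxE; under eq_fun do rewrite mxE.
exact: Ck_continuous (Dphi _) Uz.
Qed.

(** Along the line each homogeneous term is a polynomial in [t] whose linear coefficient is given by
    [Dpow_line]; the identity $i/i! = 1/(i-1)!$ then shifts the sum into [taylor_grad]. *)
Lemma is_derive_taylor p phi x z h : Ck U p phi -> U x ->
  is_derive (0 : R) (1 : R) (fun t => taylor p phi (z + t *: h) x)
    (dotv (taylor_grad p phi x z) h).
Proof.
move=> Cphi Ux.
have -> : (fun t => taylor p phi (z + t *: h) x) =
    (fun t => \sum_(i < p.+1) i`!%:R^-1 * Dpow phi i x (z - x + t *: h)).
  by apply/funext => t; rewrite taylorE; apply: eq_bigr => i _; rewrite addrAC.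
have -> : dotv (taylor_grad p phi x z) h =
    \sum_(i < p.+1) i`!%:R^-1 * (i%:R * Dpow ('D_h phi) i.-1 x (z - x)).
  rewrite big_ord_recl/= mul0r mulr0 add0r.
  have fE k (a : R) : (k.+1)`!%:R^-1 * (k.+1%:R * a) = k`!%:R^-1 * a.
    by rewrite factS natrM; field; rewrite nat1r !pnatr_eq0 -!lt0n fact_gt0.
  transitivity (\sum_(i < p) \sum_j
      i`!%:R^-1 * (Dpow ('D_(delta_mx 0 j) phi) i x (z - x) * h 0 j)); last first.
    apply: eq_bigr => i _; rewrite /bump/= add1n fE -mulr_sumr; congr (_ * _).
    have Ci : Ck U i.+1 phi by apply: Ck_le Cphi; exact: ltn_ord.
    rewrite (Dpow_derive_dotv oU h (z - x) Ci Ux).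
    by apply: eq_bigr => j _; rewrite mxE.
  rewrite exchange_big/=; apply: eq_bigr => j _.
  by rewrite mxE mulr_suml; apply: eq_bigr => i _; rewrite mulrA.
apply: is_derive_sumr => i.
have Ci : Ck U i phi by apply: Ck_le Cphi; rewrite -ltnS; exact: ltn_ord.
have [a [aE a1]] := Dpow_line oU (z - x) h Ci Ux.
rewrite -a1.
have -> : (fun t => i`!%:R^-1 * Dpow phi i x (z - x + t *: h)) =
    i`!%:R^-1 *: (fun t => \sum_(m < i.+1) a m * t ^+ m).
  by apply/funext => t; rewrite aE.
apply: is_deriveZ; apply: is_derive_eq (is_derive_polynomial0 a i) _.
by move: a1; case: (i : nat) => // ->; rewrite mul0r.
Qed.

Lemma continuous_taylor p phi x : Ck U p phi -> U x ->
  continuous (fun z => taylor p phi z x).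
Proof.
move=> Cphi Ux z.
rewrite (_ : (fun z => _) =
  fun z => \sum_(i < p.+1) i`!%:R^-1 * Dpow phi i x (z - x)); last first.
  by apply/funext => y; rewrite taylorE.
apply: (@cvg_sumr R E (nbhs z) _) => i.
apply: cvgM; first exact: cvg_cst.
have Ci : Ck U i phi by apply: Ck_le Cphi; rewrite -ltnS; exact: ltn_ord.
apply: (@continuous_comp _ _ _ (fun z => z - x) (Dpow phi i x)).
  exact: continuous_subr.
exact: (continuous_Dpow oU Ci Ux).
Qed.

Lemma continuous_taylor_grad p phi x : Ck U p phi -> U x ->
  continuous (taylor_grad p phi x).
Proof.
move=> Cphi Ux z; apply: (@cvg_row R n E (nbhs z) _) => j.
rewrite mxE; under eq_fun do rewrite mxE.
apply: (@cvg_sumr R E (nbhs z) _) => i.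
apply: cvgM; first exact: cvg_cst.
have [_ Ci] : Ck U i.+1 phi by apply: Ck_le Cphi; exact: ltn_ord.
apply: (@continuous_comp _ _ _ (fun z => z - x) (Dpow _ i x)).
  exact: continuous_subr.
exact: (continuous_Dpow oU (Ci _) Ux).
Qed.

Lemma is_derive_Dpow_line k i phi x h (t : R) : (i < k)%N -> Ck U k phi ->
  U (x + t *: h) ->
  is_derive t (1 : R) (fun t => Dpow phi i (x + t *: h) h)
    (Dpow phi i.+1 (x + t *: h) h).
Proof.
move=> ik Cphi Ut; apply: is_derive_line; apply: diff_derivable.
have [Di _] : Ck U 1 (iter i (fun u => 'D_h u) phi).
  by apply: Ck_iter; rewrite addn1; exact: Ck_le Cphi.
exact: Di.
Qed.

End Open.

(** * Taylor estimates for a Lipschitz highest derivative *)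

Section Lipschitz.
Variables (U D : set E) (oU : open U) (DU : D `<=` U) (cD : convex_set D).
Variables (p : nat) (L : R) (phi : E -> R).
Hypothesis Cphi : Ck U p phi.
Hypothesis L0 : 0 < L.
Hypothesis p0 : (0 < p)%N.
Hypothesis lip : forall x y, D x -> D y ->
  (form_norm (fun h => Dpow phi p x h - Dpow phi p y h)%R
     <= (L * enorm (x - y))%:E)%E.

(** The form norm controls only directions of norm at most 1; homogeneity of degree [p] extends the
    bound to every [h]. At [h = 0] both sides vanish because [p] is positive. *)
Lemma Dpow_lipschitz x y h : D x -> D y ->
  `|Dpow phi p x h - Dpow phi p y h| <= L * enorm (x - y) * enorm h ^+ p.
Proof.
move=> Dx Dy.
have H1 : forall h, enorm h <= 1 ->
    `|Dpow phi p x h - Dpow phi p y h| <= L * enorm (x - y).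
  move=> k k1; rewrite -lee_fin (le_trans _ (lip Dx Dy))//.
  by apply: ereal_sup_ubound; exists k.
have [/enorm_eq0 ->|h0] := eqVneq (enorm h) 0.
  rewrite -(scale0r 0) !(Dpow_homog oU _ _ Cphi (DU _))//.
  by rewrite expr0n eqn0Ngt p0/= !mul0r subrr normr0 scale0r enorm0 expr0n eqn0Ngt p0 mulr0.
have hp : 0 < enorm h by rewrite lt_def h0 enorm_ge0.
have [k k1 hE] : exists2 k, enorm k <= 1 & h = enorm h *: k.
  exists ((enorm h)^-1 *: h); last by rewrite scalerA divff// scale1r.
  by rewrite enormZ ger0_norm ?invr_ge0 ?enorm_ge0// mulVf.
rewrite [in leLHS]hE !(Dpow_homog oU _ _ Cphi (DU _))// -mulrBr normrM.
rewrite normrX ger0_norm ?enorm_ge0// mulrC ler_wpM2r ?exprn_ge0 ?enorm_ge0//.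
exact: H1.
Qed.

(** The one-variable remainder on the segment from [x] to [y]. Its constant carries $|d|^{p+1}$: [p]
    powers come from the direction and one from the displacement. *)
Lemma taylor_error x y : D x -> D y ->
  `|phi y - taylor p phi y x| <= L / p.+1`!%:R * enorm (y - x) ^+ p.+1.
Proof.
move=> Dx Dy; pose d := y - x.
have Dl (t : R) : 0 <= t <= 1 -> D (x + t *: d) by exact: convex_set_line.
have := @taylor_remainder R p (fun i t => Dpow phi i (x + t *: d) d)
  (L * enorm d ^+ p.+1) _ _ 1.
rewrite taylorE !scale1r !scale0r !addr0 expr1n mulr1.
have -> : x + d = y by rewrite addrC subrK.
rewrite [_ / _ * enorm _ ^+ _]mulrAC -/d.
under eq_bigr do rewrite expr1n mulr1.
apply; last by rewrite ler01 lexx.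
- move=> i t ip t01; exact: (is_derive_Dpow_line ip Cphi (DU (Dl _ t01))).
- move=> t t01.
  rewrite (le_trans (Dpow_lipschitz _ (Dl _ t01) Dx))//.
  have /andP[t0 _] := t01.
  rewrite addrAC subrr add0r enormZ ger0_norm// exprS.
  by rewrite le_eqVlt; apply/orP; left; apply/eqP; ring.
Qed.

(** The difference of the diagonals at [x] and [y] along a line of directions is a bounded
    polynomial, and [linear_coef_bound] extracts from it the difference of the mixed values. *)
Lemma Dpow_derive_lipschitz : exists2 C : R, 0 <= C &
  forall x y h v, D x -> D y -> enorm h != 0 -> enorm v <= 1 ->
  `|Dpow ('D_v phi) p.-1 x h - Dpow ('D_v phi) p.-1 y h|
    <= C * enorm (x - y) * enorm h ^+ p.-1.
Proof.
have [C C0 HC] := @linear_coef_bound R p p0.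
exists (C * L * 2 ^+ p); first by rewrite !mulr_ge0 ?exprn_ge0// ltW.
move=> x y h v Dx Dy h0 v1.
have hp : 0 < enorm h by rewrite lt_def h0 enorm_ge0.
(* Scaling [v] by [enorm h] keeps the directions within norm [2 * enorm h] for $|s|\le 1$, so that
   dividing by [enorm h] leaves the power [p - 1]. *)
have [a [aE a1]] := Dpow_line oU h (enorm h *: v) Cphi (DU Dx).
have [b [bE b1]] := Dpow_line oU h (enorm h *: v) Cphi (DU Dy).
have := HC (fun m => a m - b m) (L * enorm (x - y) * (2 * enorm h) ^+ p) _.
have Cp : Ck U p.-1.+1 phi by rewrite prednK.
rewrite a1 b1 !(Dpow_derive_dotv oU (enorm h *: v) _ Cp (DU _))// !dotvZr.
rewrite -!(Dpow_derive_dotv oU v _ Cp (DU _))//.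
rewrite -mulrBr -mulrBr normrM normrM normr_nat (ger0_norm (enorm_ge0 h)).
move=> H; rewrite -(ler_pM2l hp).
apply: (@le_trans _ _ (p%:R * (enorm h *
   `|Dpow ('D_v phi) p.-1 x h - Dpow ('D_v phi) p.-1 y h|))).
  by rewrite ler_peMl ?mulr_ge0 ?enorm_ge0// ler1n.
apply: le_trans (H _) _; last first.
  rewrite exprMn -{2}(prednK p0) exprS.
  by rewrite le_eqVlt; apply/orP; left; apply/eqP; ring.
move=> s s1.
under eq_bigr do rewrite mulrBl.
rewrite sumrB -aE -bE (le_trans (Dpow_lipschitz _ Dx Dy))//.
rewrite ler_wpM2l ?mulr_ge0 ?enorm_ge0 ?(ltW L0)// lerXn2r ?nnegrE ?mulr_ge0 ?enorm_ge0//.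
rewrite (le_trans (enormD_le _ _))// !enormZ (ger0_norm (enorm_ge0 h)).
have : `|s| * (enorm h * enorm v) <= 1 * (enorm h * 1).
  by rewrite ler_pM ?mulr_ge0 ?enorm_ge0// ler_wpM2l ?enorm_ge0.
by lra.
Qed.

(** Each partial derivative has a Taylor expansion of order [p - 1] whose highest derivative is
    Lipschitz by [Dpow_derive_lipschitz]. Summing over coordinates costs the factor [n]. *)
Lemma taylor_grad_error : exists2 C : R, 0 <= C & forall x y, D x -> D y ->
  enorm (egrad phi y - taylor_grad p phi x y) <= C * enorm (y - x) ^+ p.
Proof.
have [C C0 HC] := Dpow_derive_lipschitz.
exists (n%:R * C); first by rewrite mulr_ge0.
move=> x y Dx Dy; rewrite (le_trans (enorm_le_sum_coord _))//.
suff H (j : 'I_n) : `|(egrad phi y - taylor_grad p phi x y) 0 j|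
    <= C * enorm (y - x) ^+ p.
  rewrite (le_trans (ler_sum _ (fun j _ => H j)))// sumr_const card_ord.
  by rewrite -[leLHS]mulr_natl mulrA.
rewrite !mxE; pose v : E := delta_mx 0 j; rewrite -/v; pose d := y - x.
have Dl (t : R) : 0 <= t <= 1 -> D (x + t *: d) by exact: convex_set_line.
have v1 : enorm v <= 1 by rewrite /enorm dotv_delta mxE !eqxx sqrtr1.
have Cv : Ck U p.-1 ('D_v phi).
  have [_ H] : Ck U p.-1.+1 phi by rewrite prednK.
  exact: H.
have := @taylor_remainder R p.-1 (fun i t => Dpow ('D_v phi) i (x + t *: d) d)
  (C * enorm d ^+ p) _ _ 1.
rewrite !scale1r expr1n mulr1 prednK//.
have -> : x + d = y by rewrite addrC subrK.
under eq_bigr do rewrite expr1n mulr1 scale0r addr0.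
move=> H; apply: le_trans (H _ _ _) _.
- move=> i t ip t01; exact: (is_derive_Dpow_line ip Cv (DU (Dl _ t01))).
- move=> t t01; have /andP[t0 _] := t01.
  rewrite scale0r addr0.
  (* The polarized Lipschitz bound is available only for a nonzero direction. *)
  have [/enorm_eq0 d0|d0] := eqVneq (enorm d) 0.
    by rewrite d0 scaler0 addr0 subrr normr0 !mulr_ge0// exprn_ge0// enorm_ge0.
  rewrite (le_trans (HC _ _ _ _ (Dl _ t01) Dx d0 v1))//.
  rewrite addrAC subrr add0r enormZ ger0_norm// -{2}(prednK p0) exprS.
  by rewrite le_eqVlt; apply/orP; left; apply/eqP; ring.
- by rewrite ler01 lexx.
- rewrite ler_pdivrMr ?ltr0n ?fact_gt0// ler_peMr ?mulr_ge0 ?exprn_ge0 ?enorm_ge0//.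
  by rewrite ler1n fact_gt0.
Qed.

End Lipschitz.

(** Collects the analytic facts used later and hides the open set [U]. The Taylor polynomial and its
    gradient are polynomials in [z], so their regularity holds for all [z], not only in [D]. *)
Lemma smooth_convex_model p L D phi : (0 < p)%N -> convex_set D ->
  smooth_convex p L D phi ->
  [/\ forall x, D x -> differentiable phi x /\ {for x, continuous (egrad phi)},
      forall x y, D x -> D y ->
        `|phi y - taylor p phi y x| <= L / p.+1`!%:R * enorm (y - x) ^+ p.+1,
      forall x, D x -> [/\ continuous (fun z => taylor p phi z x),
        continuous (taylor_grad p phi x) &
        forall z h, is_derive (0 : R) (1 : R)
          (fun t => taylor p phi (z + t *: h) x) (dotv (taylor_grad p phi x z) h)] &
      exists2 C : R, 0 <= C & forall x y, D x -> D y ->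
        enorm (egrad phi y - taylor_grad p phi x y) <= C * enorm (y - x) ^+ p].
Proof.
move=> p0 cD [_ [U [oU _ DU Cphi]] L0 lip]; split.
- move=> x Dx; split; last exact: continuous_egrad p0 Cphi (DU _ Dx).
  by case: p p0 Cphi {lip} => // p _ [dphi _]; exact: dphi (DU _ Dx).
- by move=> x y Dx Dy; apply: (taylor_error oU DU cD Cphi).
- move=> x Dx; split.
  + by apply: (continuous_taylor oU Cphi); exact: DU.
  + by apply: (continuous_taylor_grad oU Cphi); exact: DU.
  + by move=> z h; apply: (is_derive_taylor oU _ _ Cphi); exact: DU.
- by apply: (taylor_grad_error (L := L) oU DU cD Cphi).
Qed.

End TaylorModel.

(** * Subgradients and the concavity inequality *)

Section RealTools.
Context {R : realType}.
Implicit Types (c d t s : R).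

(** Only right difference quotients enter, which suits inequalities known only on a segment starting
    at the base point. *)
Lemma derive_ge_right (u : R -> R) c d : is_derive (0 : R) (1 : R) u d ->
  (\forall t \near (0 : R)^'+, c * t <= u t - u 0) -> c <= d.
Proof.
move=> [Du <-] H.
have L : (fun t : R => t^-1 *: ((u \o shift 0) (t *: (1 : R)) - u 0)) @ (0 : R)^'+
    --> 'D_1 u 0.
  exact: cvg_dnbhs_at_right Du.
apply: (cvgr_to_ge L); near=> t.
have t0 : 0 < t by near: t; exact: nbhs_right_gt.
rewrite /= addr0 [t *: 1]mulr1 /GRing.scale/= -ler_pdivrMl ?invr_gt0// invrK mulrC.
by near: t.
Unshelve. all: by end_near. Qed.

(** Concavity on the segment from [s] to [t] bounds the difference quotient at [s] below by
    [kappa t - kappa s]. Differentiability is needed only at [s], so [t] may be an endpoint. *)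
Lemma concave_tangent (eps : R) (kappa : R -> R) s t :
  convex_function `[0, eps] (fun t : R^o => - kappa t) ->
  0 < s < eps -> 0 <= t <= eps -> derivable kappa s 1 ->
  derive1 kappa s * (s - t) <= kappa s - kappa t.
Proof.
move=> conc /andP[s0 se] /andP[t0 te] dk.
have D : is_derive (0 : R) (1 : R) (fun l : R => kappa (s + l * (t - s)))
    (derive1 kappa s * (t - s)).
  have ds : is_derive (0 : R) (1 : R) (fun l : R => s + l * (t - s)) (t - s).
    have -> : (fun l : R => s + l * (t - s)) = cst s + (t - s) *: id.
      by apply/funext => l; rewrite !fctE /= /GRing.scale/= mulrC.
    apply: is_derive_eq (is_deriveD (is_derive_cst _ _ _)
      (is_deriveZ _ (is_derive_id _ _))) _.
    by rewrite add0r /GRing.scale/= mulr1.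
  apply: (@is_derive1_comp R kappa (fun l : R => s + l * (t - s))).
  by rewrite mul0r addr0 derive1E; exact: derivableP.
suff : kappa t - kappa s <= derive1 kappa s * (t - s).
  by rewrite -[t - s]opprB mulrN lerNr opprB.
apply: (derive_ge_right D); near=> l.
have l0 : 0 < l by near: l; exact: nbhs_right_gt.
have l1 : l < 1 by near: l; exact: nbhs_right_lt.
have tin : t \in `[0, eps]%classic by rewrite inE/= in_itv/= t0.
have sin : s \in `[0, eps]%classic by rewrite inE/= in_itv/= !ltW.
have : - kappa (l * t + (1 - l) * s) <= l * (- kappa t) + (1 - l) * (- kappa s).
  exact: (conc (Itv01 (ltW l0) (ltW l1)) t s tin sin).
rewrite mul0r addr0 (_ : l * t + (1 - l) * s = s + l * (t - s)); last by ring.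
set a := kappa (s + _).
lra.
Unshelve. all: by end_near. Qed.

(** From index [N] on, the potential [series d k + 2 * d k + 2 * C * K k] is nonincreasing; as its
    last two terms are nonnegative, it bounds the partial sums. *)
Lemma summable_of_contraction (d K : nat -> R) (C : R) (N : nat) :
  (forall k, 0 <= d k) -> 0 <= C ->
  (forall k, (N <= k)%N -> 0 <= K k) ->
  (forall k, (N <= k)%N -> d k.+1 <= d k / 2 + C * (K k - K k.+1)) ->
  cvgn (series d).
Proof.
move=> d0 C0 K0 dK.
have nd : nondecreasing_seq (series d).
  apply/nondecreasing_seqP => k; rewrite -subr_ge0 /series/= big_nat_recr//=.
  by rewrite addrAC subrr add0r.
apply: nondecreasing_is_cvgn => //.
have H m : series d (N + m)%N + 2 * d (N + m)%N + 2 * C * K (N + m)%N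
    <= series d N + 2 * d N + 2 * C * K N.
  elim: m => [|m]; first by rewrite addn0.
  apply: le_trans; rewrite addnS /series/= big_nat_recr//=.
  have := dK (N + m)%N (leq_addr _ _); lra.
exists (series d N + 2 * d N + 2 * C * K N) => _ [k _ <-].
have HN := H 0%N; rewrite addn0 in HN.
have [Nk|kN] := leqP N k.
  have := H (k - N)%N; rewrite subnKC//.
  have := K0 _ Nk; have := d0 k => a b.
  have := mulr_ge0 C0 b; lra.
have := nd _ _ (ltnW kN); have := d0 N; have := mulr_ge0 C0 (K0 N (leqnn _)).
lra.
Qed.

End RealTools.

(** * Derivatives of norm powers, stationarity and Frechet subgradients *)

Section Subgradients.
Context {R : realType} {n : nat}.
Local Notation E := 'rV[R]_n.
Implicit Types (f g : E -> R) (psi phi : E -> \bar R) (x y z h v w s : E) (p : nat).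

Lemma is_derive_enormX p z h : (0 < p)%N ->
  is_derive (0 : R) (1 : R) (fun t : R => enorm (z + t *: h) ^+ p.+1)
    (p.+1%:R * enorm z ^+ p.-1 * dotv z h).
Proof.
case: p => // p _ /=.
(* The norm is not differentiable at 0, so there the difference quotient is computed directly and
   tends to 0; elsewhere the norm is the square root of a positive quadratic [q]. *)
have [z0|z0] := eqVneq (enorm z) 0.
  rewrite (enorm_eq0 z0) dotv0l mulr0.
  have E1 : (fun t : R => enorm (0 + t *: h) ^+ p.+2) =
      (fun t : R => t ^+ 2 * (`|t| ^+ p * enorm h ^+ p.+2)).
    apply/funext => t.
    have T2 : `|t| ^+ p.+2 = t ^+ 2 * `|t| ^+ p.
      by rewrite -[p.+2]add2n exprD real_normK ?num_real.
    by rewrite add0r enormZ exprMn T2 -mulrA.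
  rewrite E1.
  have L : (fun t : R => t^-1 *: (((fun t : R => t ^+ 2 * (`|t| ^+ p * enorm h ^+ p.+2))
      \o shift 0) (t *: (1 : R)) - 0 ^+ 2 * (`|0 : R| ^+ p * enorm h ^+ p.+2)))
      @ (0 : R)^' --> (0 : R).
    have C : (fun t : R => t * (`|t| ^+ p * enorm h ^+ p.+2)) @ (0 : R)^'
        --> (0 : R) * (`|0 : R| ^+ p * enorm h ^+ p.+2).
      apply: cvg_within_filter; apply: cvgM; first exact: cvg_id.
      apply: cvgM; last exact: cvg_cst.
      apply: (@continuous_comp _ _ _ (fun t : R => `|t|) (fun t => t ^+ p)).
        exact: norm_continuous.
      exact: exprn_continuous.
    rewrite mul0r in C; apply: cvg_trans C; apply: near_eq_cvg.
    near=> t.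
    have t0 : t != 0 by near: t; exact: nbhs_dnbhs_neq.
    rewrite /= addr0 [t *: 1]mulr1 /GRing.scale/= expr0n/= mul0r subr0 expr2.
    by rewrite !mulrA mulVf// mul1r.
  split; first by apply/cvg_ex; exists 0.
  by apply: cvg_lim L.
have zp : 0 < enorm z by rewrite lt_def z0 enorm_ge0.
pose q (t : R) := dotv z z + t * (2 * dotv z h) + t ^+ 2 * dotv h h.
have qE t : dotv (z + t *: h) (z + t *: h) = q t.
  rewrite /q dotvDl !dotvDr !dotvZl !dotvZr (dotvC h z); ring.
have dq : is_derive (0 : R) (1 : R) q (2 * dotv z h).
  have -> : q = cst (dotv z z) + (2 * dotv z h) *: id + dotv h h *: (id ^+ 2).
    by apply/funext => t; rewrite /q !fctE /GRing.scale/=; ring.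
  apply: is_derive_eq (is_deriveD (is_deriveD (is_derive_cst _ _ _)
    (is_deriveZ _ (is_derive_id _ _))) (is_deriveZ _ (is_deriveX 2 (is_derive_id _ _)))) _.
  by rewrite /GRing.scale/= expr1; ring.
have q0 : q 0 = enorm z ^+ 2 by rewrite /q sqr_enorm; ring.
have dsq : is_derive (0 : R) (1 : R) (fun t : R => enorm (z + t *: h))
    (dotv z h / enorm z).
  have -> : (fun t : R => enorm (z + t *: h)) = Num.sqrt \o q.
    by apply/funext => t; rewrite /enorm qE.
  have q0' : 0 < q 0 by rewrite q0 exprn_gt0.
  have ds := @is_derive1_sqrt R _ q0'.
  apply: is_derive_eq (is_derive1_comp ds dq) _.
  rewrite q0 sqrtr_sqr ger0_norm ?enorm_ge0//.
  by field.
have -> : (fun t : R => enorm (z + t *: h) ^+ p.+2) =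
    (fun t : R => enorm (z + t *: h)) ^+ p.+2 by apply/funext => t; rewrite fctE.
apply: is_derive_eq (is_deriveX p.+2 dsq) _.
by rewrite scale0r addr0 /GRing.scale/= exprS; field.
Unshelve. all: by end_near. Qed.

Lemma continuous_enormX_grad p z0 : continuous (fun z => enorm (z - z0) ^+ p *: (z - z0)).
Proof.
move=> z.
have c1 : enorm (y - z0) @[y --> z] --> enorm (z - z0).
  by apply: (@cvg_enorm R n E (nbhs z) _); exact: continuous_subr.
have c2 : enorm (y - z0) ^+ p @[y --> z] --> enorm (z - z0) ^+ p.
  exact: (cvg_comp _ _ c1 (@exprn_continuous R p (enorm (z - z0)))).
exact: (cvgZ c2 (@continuous_subr R n z0 z)).
Qed.

Lemma differentiable_expansion f z (e : R) : differentiable f z -> 0 < e ->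
  \forall y \near z, `|f y - f z - dotv (egrad f z) (y - z)| <= e * enorm (y - z).
Proof.
move=> dz e0; have /eqaddoP /(_ e e0) := diff_locally dz.
rewrite (near_shift 0 z); apply: filterS => h /=.
rewrite subr0 !fctE /= addrK => H.
rewrite -(derive_egrad _ dz) deriveE// -addrA -opprD.
by rewrite (le_trans H)// ler_wpM2l ?(ltW e0)// normr_le_enorm.
Qed.

Lemma proper_fin psi y : eproper psi -> edom psi y -> psi y = (fine (psi y))%:E.
Proof.
move=> [psiN _] Dy; rewrite fineK// fin_numE psiN/=.
by move: Dy; rewrite /edom/= lt_neqAle => /andP[].
Qed.

Lemma fin_num_edom psi y : psi y \is a fin_num -> edom psi y.
Proof. by rewrite /edom/= ltey_eq => ->. Qed.

Lemma econvex_line psi y z (t : R) : eproper psi -> econvex psi ->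
  edom psi y -> edom psi z -> 0 <= t <= 1 ->
  (psi (z + t *: (y - z))%R <= (fine (psi z) + t * (fine (psi y) - fine (psi z)))%:E)%E.
Proof.
move=> pp cp Dy Dz /andP[t0 t1].
have := cp y z t t0 t1; rewrite (proper_fin pp Dy) (proper_fin pp Dz)/=.
rewrite -!EFinM -EFinD (_ : t *: y + (1 - t) *: z = z + t *: (y - z)).
  by move/le_trans; apply; rewrite lee_fin le_eqVlt; apply/orP; left; apply/eqP; ring.
by rewrite scalerBl scale1r scalerBr addrCA.
Qed.

(* A directional form of Fermat's rule: for convex [psi] a limiting stationary
   point of [Phi + psi] already satisfies a global subgradient inequality, so no
   subdifferential calculus is needed. *)
Lemma stationary_subgradient (Phi : E -> R) (H : E -> E) psi z :
  eproper psi -> econvex psi -> continuous Phi -> {for z, continuous H} ->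
  (forall u h, is_derive (0 : R) (1 : R) (fun t : R => Phi (u + t *: h)) (dotv (H u) h)) ->
  stationary (fun y => ((Phi y)%:E + psi y)%E) z ->
  edom psi z /\ forall y, edom psi y ->
    fine (psi z) - dotv (H z) (y - z) <= fine (psi y).
Proof.
move=> pp cp cPhi cH dPhi [zfin [u [w [uz phiu fr w0]]]].
have domE y : ((Phi y)%:E + psi y)%E \is a fin_num -> edom psi y.
  by rewrite fin_numD => /andP[_]; exact: fin_num_edom.
have Dz := domE _ zfin; split => // y Dy.
(* At each approximating point the Frechet inequality is tested on the segment towards [y];
   convexity bounds [psi] there by its chord, which leaves a bound on the directional derivative of
   [Phi]. *)
have claim k : edom psi (u k) /\ fine (psi (u k)) + dotv (w k) (y - u k)
    - dotv (H (u k)) (y - u k) <= fine (psi y).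
  have [ukfin frk] := fr k; have Du := domE _ ukfin; split => //.
  apply/ler_addgt0Pr => e e0.
  pose h := y - u k; pose e' := e / (enorm h + 1).
  have h1 : 0 < enorm h + 1 by rewrite ltr_wpDl ?enorm_ge0.
  have e'0 : 0 < e' by rewrite divr_gt0.
  suff : dotv (w k) h - e' * enorm h + fine (psi (u k)) - fine (psi y)
      <= dotv (H (u k)) h.
    have : e' * enorm h <= e.
      by rewrite /e' mulrAC ler_pdivrMr// ler_wpM2l ?(ltW e0)// lerDl.
    rewrite -/h; lra.
  apply: (derive_ge_right (dPhi (u k) h)).
  have near0 : \forall t \near (0 : R)^'+, (((Phi (u k))%:E + psi (u k) +
      (dotv (w k) (u k + t *: h - u k)%R - e' * enorm (u k + t *: h - u k)%R)%:E)
      <= ((Phi (u k + t *: h)%R)%:E + psi (u k + t *: h)%R))%E.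
    have C : (fun t : R => u k + t *: h) @ (0 : R)^'+ --> u k.
      apply: cvg_at_right_filter; rewrite -[X in _ --> X]addr0 -[X in _ + X](scale0r h).
      by apply: cvgD; [exact: cvg_cst|apply: cvgZr_tmp; exact: cvg_id].
    exact: C (frk e' e'0).
  near=> t.
  have t0 : 0 < t by near: t; exact: nbhs_right_gt.
  have t1 : t < 1 by near: t; exact: nbhs_right_lt.
  have t01 : 0 <= t <= 1 by rewrite !ltW.
  have Ht : (((Phi (u k))%:E + psi (u k) +
      (dotv (w k) (u k + t *: h - u k)%R - e' * enorm (u k + t *: h - u k)%R)%:E)
      <= ((Phi (u k + t *: h)%R)%:E + psi (u k + t *: h)%R))%E by near: t.
  have := le_trans Ht (leeD (lexx _) (econvex_line pp cp Dy Du t01)).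
  have -> : u k + t *: h - u k = t *: h by rewrite addrAC subrr add0r.
  rewrite (proper_fin pp Du)/= -!EFinD lee_fin.
  rewrite dotvZr enormZ (gtr0_norm t0) scale0r addr0.
  lra.
have cPu : Phi (u k) @[k --> \oo] --> Phi z by apply: (cvg_comp _ _ uz); exact: cPhi.
(* The limiting subdifferential provides convergence of the sum, and [Phi] is continuous, so the
   values of [psi] converge too. *)
have cps : fine (psi (u k)) @[k --> \oo] --> fine (psi z).
  have -> : (fun k => fine (psi (u k))) =
      (fun k => fine ((Phi (u k))%:E + psi (u k))%E - Phi (u k)).
    apply/funext => k; have [Du _] := claim k.
    by rewrite (proper_fin pp Du)/= addrAC subrr add0r.
  have -> : fine (psi z) = fine ((Phi z)%:E + psi z)%E - Phi z.
    by rewrite (proper_fin pp Dz)/= addrAC subrr add0r.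
  apply: cvgB => //; apply: (@fine_cvg _ _ _ _ (fun k => ((Phi (u k))%:E + psi (u k))%E)).
  by rewrite fineK.
have cHu : H (u k) @[k --> \oo] --> H z by apply: (cvg_comp _ _ uz); exact: cH.
have cyu : y - u k @[k --> \oo] --> y - z by apply: cvgB => //; exact: cvg_cst.
have L : fine (psi (u k)) + dotv (w k) (y - u k) - dotv (H (u k)) (y - u k)
    @[k --> \oo] --> fine (psi z) + dotv 0 (y - z) - dotv (H z) (y - z).
  by apply: cvgB; [apply: cvgD => //|]; apply: cvg_dotv.
rewrite dotv0l addr0 in L; apply: (cvgr_to_le L).
by apply: nearW => k; have [] := claim k.
Unshelve. all: by end_near. Qed.

Lemma objective_fin f g psi y : eproper psi -> edom psi y ->
  objective f g psi y = (f y + fine (psi y) - g y)%:E.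
Proof. by move=> pp Dy; rewrite /objective (proper_fin pp Dy). Qed.

(** The error [e] is shared equally between the first-order expansions of [f] and [g]; outside
    [edom psi] the objective is infinite and the inequality is trivial. *)
Lemma subgradient_frechet f g psi z s : eproper psi -> edom psi z ->
  differentiable f z -> differentiable g z ->
  (forall y, edom psi y -> fine (psi z) + dotv s (y - z) <= fine (psi y)) ->
  frechet_subdiff (objective f g psi) z (s + egrad f z - egrad g z).
Proof.
move=> pp Dz df dg H; split; first by rewrite objective_fin.
move=> e e0; have e20 : 0 < e / 2 by rewrite divr_gt0.
have nf := differentiable_expansion df e20.
have ng := differentiable_expansion dg e20.
apply: filterS2 nf ng => y.
have [Dy|nDy] := pselect (edom psi y); last first.
  move=> _ _; have -> : psi y = +oo%E -> objective f g psi y = +oo%E.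
  - by rewrite /objective => ->.
  - by rewrite leey.
  by apply/eqP; move/negP: nDy; rewrite -leNgt leye_eq.
rewrite !objective_fin// -EFinD lee_fin !ler_norml => /andP[f1 _] /andP[_ g2].
have := H y Dy; rewrite !dotvDl dotvNl; lra.
Qed.

Lemma frechet_limiting phi z v : frechet_subdiff phi z v -> limiting_subdiff phi z v.
Proof.
move=> fr; have [zfin _] := fr; split => //.
exists (fun=> z), (fun=> v); split => //; exact: cvg_cst.
Qed.

Lemma slope_le phi z v : frechet_subdiff phi z v -> (slope phi z <= (enorm v)%:E)%E.
Proof.
move=> /frechet_limiting fr; apply: ereal_inf_lbound; exists v => //.
by rewrite sub0r enormN.
Qed.

End Subgradients.

(** * One step of the algorithm *)

(** Brings the powers [p] and [q] of a bounded step down to the common exponent [minn p q]. The base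
    [1 + B] is at least 1, so its exponent [p - r] may be enlarged to [p]. *)
Lemma exprn_le_lower {R : realType} (d B : R) (r p : nat) :
  0 <= d -> d <= B -> (r <= p)%N -> d ^+ p <= (1 + B) ^+ p * d ^+ r.
Proof.
move=> d0 dB rp; have B1 : 1 <= 1 + B by rewrite lerDl (le_trans d0).
rewrite -[in leLHS](subnK rp) exprD ler_wpM2r ?exprn_ge0//.
apply: (@le_trans _ _ ((1 + B) ^+ (p - r))); last by rewrite ler_weXn2l ?leq_subr.
by rewrite lerXn2r ?nnegrE//; move: d0 dB B1; lra.
Qed.

(* Either [t <= s / 2], or [s < 2 t] and one factor [t ^+ r] cancels. *)
Lemma contraction_alternative {R : realType} (a b Delta s t : R) (r : nat) :
  0 < a -> 0 <= b -> 0 <= s -> 0 <= t -> 0 <= Delta ->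
  a * t ^+ r.+1 <= b * Delta * s ^+ r ->
  t <= s / 2 + b * 2 ^+ r / a * Delta.
Proof.
move=> a0 b0 s0 t0 D0 H.
have bD : 0 <= b * 2 ^+ r / a * Delta.
  by rewrite !mulr_ge0 ?exprn_ge0// invr_ge0 ltW.
have [ts|st] := lerP t (s / 2); first by rewrite (le_trans ts)// lerDl.
have tp : 0 < t by rewrite (le_lt_trans _ st)// divr_ge0.
have : t <= b * 2 ^+ r / a * Delta.
  rewrite -(ler_pM2l a0) -(@ler_pM2r _ (t ^+ r)) ?exprn_gt0//.
  rewrite -mulrA -exprS (le_trans H)//.
  have -> : a * (b * 2 ^+ r / a * Delta) * t ^+ r = b * Delta * (2 * t) ^+ r.
    by rewrite exprMn; field; rewrite gt_eqF.
  rewrite ler_wpM2l ?mulr_ge0// lerXn2r ?nnegrE ?mulr_ge0//.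
  by move: st; lra.
by move/le_trans; apply; rewrite lerDr divr_ge0.
Qed.

(** * Cluster sets of bounded sequences, and summable steps *)

Section BoundedSequence.
Context {R : realType} {n : nat}.
Local Notation E := 'rV[R]_n.
Variables (x : nat -> E) (B : R).
Hypothesis xB : forall k, enorm (x k) <= B.

(** Otherwise infinitely many terms avoid [A]; by compactness of the ball they cluster at some [z],
    which is also a cluster point of [x] and so has [A] as a neighbourhood. *)
Lemma bounded_cluster_near (A : set E) :
  (forall z, cluster (x @ \oo) z -> nbhs z A) -> \forall k \near \oo, A (x k).
Proof.
move=> clA; apply: contrapT => nA.
(* This filter plays the role of the subsequence of terms outside [A]. *)
pose G := x @ within (fun k => ~ A (x k)) \oo.
have FG : Filter (within (fun k => ~ A (x k)) (@nbhs nat _ \oo)) by exact: within_filter.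
have GF : ProperFilter G.
  apply: Build_ProperFilter => G0; apply: nA.
  have {}G0 : \forall k \near \oo, ~ A (x k) -> False by exact: G0.
  by apply: filterS G0 => k H; apply: contrapT.
pose K : set E := [set v | enorm v <= B].
have cK : compact K.
  apply: bounded_closed_compact.
    exists B; split; first exact: num_real.
    by move=> M BM v /= vB; rewrite (le_trans (normr_le_enorm v))// (le_trans vB)// ltW.
  apply: (@closed_comp _ _ (@enorm R n) [set r | r <= B]); last exact: closed_le.
  move=> v _; apply: (@cvg_enorm R n E (nbhs v) _); exact: cvg_id.
have [z [_ zG]] : K `&` cluster G !=set0.
  by apply: cK; apply: nearW => k _; exact: xB.
have zx : cluster (x @ \oo) z.
  apply: cvg_cluster zG; apply: cvg_app; exact: cvg_within.
have [v [nAv Av]] : (~` A) `&` A !=set0.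
  apply: zG (clA _ zx).
  by apply: nearW => k.
exact: nAv.
Qed.

Lemma bounded_cluster_nonempty : cluster (x @ \oo) !=set0.
Proof.
apply: contrapT => /forallNP H.
have [k []] := filter_ex (bounded_cluster_near (A := set0) (fun z zx => False_ind _ (H z zx))).
Qed.

Lemma near_edist_cluster (delta : R) : 0 < delta ->
  \forall k \near \oo, (edist_set (x k) (cluster (x @ \oo)) <= delta%:E)%E.
Proof.
move=> d0.
apply: (bounded_cluster_near
  (A := [set v | (edist_set v (cluster (x @ \oo)) <= delta%:E)%E])) => z zx.
have : enorm (v - z) @[v --> z] --> enorm (z - z).
  by apply: (@cvg_enorm R n E (nbhs z) _); exact: continuous_subr.
rewrite subrr enorm0 => /cvgr_lt /(_ _ d0); apply: filterS => v vd.
rewrite /= (le_trans (ereal_inf_lbound (x := (enorm (v - z))%:E) _))//.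
  by exists z.
by rewrite lee_fin ltW.
Qed.

End BoundedSequence.

(** In each coordinate the telescoping series converges absolutely, by comparison with the lengths
    of the steps. *)
Lemma cvg_of_summable_steps {R : realType} {n : nat} (x : nat -> 'rV[R]_n) :
  cvgn (series (fun k => enorm (x k.+1 - x k))) -> cvgn x.
Proof.
move=> H.
have Hj (j : 'I_n) : cvgn (fun k => x k 0 j).
  have Hn : cvgn [normed series (telescope (fun k => x k 0 j))].
    apply: series_le_cvg H => k; first exact: normr_ge0.
      exact: enorm_ge0.
    rewrite (le_trans _ (ler_coord_enorm _ j))//.
    by rewrite /telescope/= !mxE.
  have := @normed_cvg R R^o _ Hn; rewrite telescopeK => Hx.
  have -> : (fun k => x k 0 j) = (fun k => (x k 0 j - x 0%N 0 j) + x 0%N 0 j).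
    by apply/funext => k; rewrite subrK.
  by apply: is_cvgD => //; exact: is_cvg_cst.
apply/cvg_ex; exists (\row_j limn (fun k => x k 0 j)).
by apply: cvg_row => j; rewrite mxE; exact: Hj.
Qed.

(** * Descent and subgradient bound for one step *)

Section Step.
Context {R : realType} {n : nat}.
Local Notation E := 'rV[R]_n.
Implicit Types (f g : E -> R) (psi : E -> \bar R) (x y z : E) (p q : nat).

Lemma taylor_self p f x : taylor p f x x = f x.
Proof.
rewrite /taylor big1_seq ?addr0// => i /andP[_]; rewrite mem_index_iota.
by case: i => // i _; rewrite /Dpow subrr iterS derive0 mulr0.
Qed.

(** The constants depend on the step only through the bound [B], hence are uniform along the
    sequence. The subgradient of $F$ is kept as a global inequality for [psi], a form that passes to
    limits. *)
Lemma HO_DC_step p q Lf Lg Mp Mq f g psi (B : R) : (0 < p)%N -> (0 < q)%N ->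
  smooth_convex p Lf (edom psi) f -> smooth_convex q Lg (edom psi) g ->
  eproper psi -> econvex psi -> convex_set (edom psi) -> Lf < Mp -> Lg < Mq ->
  exists a b : R, [/\ 0 < a, 0 <= b &
    forall x y, edom psi x -> enorm (y - x) <= B ->
      stationary (fun y => model p q Mp Mq f g psi y x) y ->
      (model p q Mp Mq f g psi y x <= model p q Mp Mq f g psi x x)%E ->
      [/\ edom psi y,
        a * enorm (y - x) ^+ (minn p q).+1 <=
          (f x + fine (psi x) - g x) - (f y + fine (psi y) - g y) &
        exists2 w, enorm w <= b * enorm (y - x) ^+ minn p q &
          forall z, edom psi z ->
            fine (psi y) + dotv (w - egrad f y + egrad g y) (z - y) <= fine (psi z)]].
Proof.
move=> p0 q0 sf sg pp cp cD LMp LMq.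
have [_ fT fM [Cf Cf0 fG]] := smooth_convex_model p0 cD sf.
have [_ gT gM [Cg Cg0 gG]] := smooth_convex_model q0 cD sg.
have Lf0 : 0 < Lf by case: sf.
have Lg0 : 0 < Lg by case: sg.
pose cM := Mp / p.+1`!%:R; pose cN := Mq / q.+1`!%:R.
have cM0 : 0 < cM by rewrite divr_gt0 ?ltr0n ?fact_gt0// (lt_trans Lf0).
have cN0 : 0 < cN by rewrite divr_gt0 ?ltr0n ?fact_gt0// (lt_trans Lg0).
pose cL := Lf / p.+1`!%:R; pose cK := Lg / q.+1`!%:R.
have LM1 : cL < cM by rewrite ltr_pM2r// invr_gt0 ltr0n fact_gt0.
have LM2 : cK < cN by rewrite ltr_pM2r// invr_gt0 ltr0n fact_gt0.
(* The model exceeds $F$ by at least $(c_M-c_L)d^{p+1}+(c_N-c_K)d^{q+1}$; only the term with the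
   smaller exponent is kept. *)
pose a := if (p <= q)%N then cM - cL else cN - cK.
(* Each constant adds the Taylor error of a gradient to the size of the gradient of the
   regularization term. *)
pose bp := Cf + cM * p.+1%:R; pose bq := Cg + cN * q.+1%:R.
have bp0 : 0 <= bp by rewrite addr_ge0// mulr_ge0// ltW.
have bq0 : 0 <= bq by rewrite addr_ge0// mulr_ge0// ltW.
exists a, (bp * (1 + `|B|) ^+ p + bq * (1 + `|B|) ^+ q); split.
- by rewrite /a; case: ifP; rewrite subr_gt0.
- by rewrite addr_ge0// mulr_ge0// exprn_ge0// addr_ge0.
move=> x y Dx yB.
have [cTf cGf dTf] := fM x Dx; have [cTg cGg dTg] := gM x Dx.
pose Phi z := taylor p f z x + cM * enorm (z - x) ^+ p.+1 - taylor q g z x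
  + cN * enorm (z - x) ^+ q.+1.
have mE z : model p q Mp Mq f g psi z x = ((Phi z)%:E + psi z)%E.
  rewrite /model; have := pp.1 z; case: (psi z) => [r| |] // _.
  by rewrite -!EFinD /Phi -/cM -/cN; congr EFin; ring.
pose rp z := enorm (z - x) ^+ p.-1 *: (z - x).
pose rq z := enorm (z - x) ^+ q.-1 *: (z - x).
(* The gradient of the finite part [Phi] of the model. *)
pose H z := taylor_grad p f x z + (cM * p.+1%:R) *: rp z
  - taylor_grad q g x z + (cN * q.+1%:R) *: rq z.
have cenorm : continuous (fun z : E => enorm (z - x)).
  by move=> z; apply: (@cvg_enorm R n E (nbhs z) _); exact: continuous_subr.
have cpow m : continuous (fun z : E => enorm (z - x) ^+ m).
  move=> z; exact: (cvg_comp _ _ (cenorm z) (@exprn_continuous R m (enorm (z - x)))).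
have cpowM (c : R) m : continuous (fun z : E => c * enorm (z - x) ^+ m).
  by move=> z; exact: (cvgM (cvg_cst c) (cpow m z)).
have cPhi : continuous Phi.
  move=> z.
  exact: (cvgD (cvgB (cvgD (cTf z) (cpowM cM p.+1 z)) (cTg z)) (cpowM cN q.+1 z)).
have cZ (c : R) m : continuous (fun z : E => c *: (enorm (z - x) ^+ m *: (z - x))).
  move=> z; exact: (cvgZ (cvg_cst c) (@continuous_enormX_grad R n m x z)).
have cH : continuous H.
  move=> z.
  exact: (cvgD (cvgB (cvgD (cGf z) (cZ _ p.-1 z)) (cGg z)) (cZ _ q.-1 z)).
have dPhi u h : is_derive (0 : R) (1 : R) (fun t : R => Phi (u + t *: h)) (dotv (H u) h).
  have dp := is_derive_enormX (u - x) h p0.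
  have dq := is_derive_enormX (u - x) h q0.
  have -> : (fun t : R => Phi (u + t *: h)) =
      (fun t : R => taylor p f (u + t *: h) x)
      + cM *: (fun t : R => enorm (u - x + t *: h) ^+ p.+1)
      - (fun t : R => taylor q g (u + t *: h) x)
      + cN *: (fun t : R => enorm (u - x + t *: h) ^+ q.+1).
    by apply/funext => t; rewrite /Phi !fctE /= -(addrAC u (t *: h)).
  apply: is_derive_eq (is_deriveD (is_deriveB (is_deriveD (dTf u h)
    (is_deriveZ cM dp)) (dTg u h)) (is_deriveZ cN dq)) _.
  rewrite /H /rp /rq !dotvDl !dotvZl !dotvDl !dotvNl /GRing.scale/=; ring.
move=> st le.
have st' : stationary (fun y => ((Phi y)%:E + psi y)%E) y.
  by rewrite (_ : (fun y => _) = (fun y => model p q Mp Mq f g psi y x))//; apply/funext.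
have [Dy sub] := stationary_subgradient pp cp cPhi (cH y) dPhi st'.
pose d := enorm (y - x); have d0 : 0 <= d by exact: enorm_ge0.
have dB : d <= `|B| by rewrite (le_trans yB)// ler_norm.
have rp_ : (minn p q <= p)%N by exact: geq_minl.
have rq_ : (minn p q <= q)%N by exact: geq_minr.
split => //.
  move: le; rewrite !mE (proper_fin pp Dy) (proper_fin pp Dx) -!EFinD lee_fin.
  rewrite /Phi !taylor_self subrr enorm0 !expr0n/= !mulr0 !addr0 -/d => le.
  have := fT x y Dx Dy; have := gT x y Dx Dy.
  rewrite -/cL -/cK -/d !ler_norml => /andP[g1 _] /andP[_ f1].
  have dp0 : 0 <= (cM - cL) * d ^+ p.+1 by rewrite mulr_ge0 ?exprn_ge0// subr_ge0 ltW.
  have dq0 : 0 <= (cN - cK) * d ^+ q.+1 by rewrite mulr_ge0 ?exprn_ge0// subr_ge0 ltW.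
  have : a * d ^+ (minn p q).+1 <= (cM - cL) * d ^+ p.+1 + (cN - cK) * d ^+ q.+1.
    rewrite /a; case: leqP => pq.
      by rewrite lerDl.
    by rewrite lerDr.
  move: le g1 f1; rewrite !mulrBl.
  move: (cM * _) (cL * _) (cN * _) (cK * _) (a * _) => m1 m2 m3 m4 m5.
  lra.
(* This is [egrad f y - egrad g y - H y], grouped so that every piece is of order $d^p$ or $d^q$. *)
exists ((egrad f y - taylor_grad p f x y) - (egrad g y - taylor_grad q g x y)
    - (cM * p.+1%:R) *: rp y - (cN * q.+1%:R) *: rq y).
  have e1 : enorm (rp y) = d ^+ p.
    rewrite enormZ ger0_norm ?exprn_ge0 ?enorm_ge0// -/d.
    by rewrite -exprSr prednK.
  have e2 : enorm (rq y) = d ^+ q.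
    rewrite enormZ ger0_norm ?exprn_ge0 ?enorm_ge0// -/d.
    by rewrite -exprSr prednK.
  apply: (@le_trans _ _ (bp * d ^+ p + bq * d ^+ q)).
    apply: le_trans (enormD_le _ _) _; rewrite enormN enormZ e2.
    rewrite (ger0_norm (mulr_ge0 (ltW cN0) (ler0n _ _))).
    have := enormD_le (egrad f y - taylor_grad p f x y
      - (egrad g y - taylor_grad q g x y)) (- ((cM * p.+1%:R) *: rp y)).
    rewrite enormN enormZ e1 (ger0_norm (mulr_ge0 (ltW cM0) (ler0n _ _))).
    have := enormD_le (egrad f y - taylor_grad p f x y)
      (- (egrad g y - taylor_grad q g x y)).
    rewrite enormN; have := fG x y Dx Dy; have := gG x y Dx Dy; rewrite -/d /bp /bq.
    rewrite !mulrDl; lra.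
  have h1 := ler_wpM2l bp0 (exprn_le_lower d0 dB rp_).
  have h2 := ler_wpM2l bq0 (exprn_le_lower d0 dB rq_).
  apply: le_trans (lerD h1 h2) _.
  by rewrite le_eqVlt; apply/orP; left; apply/eqP; ring.
move=> z Dz; have := sub z Dz.
have -> : egrad f y - taylor_grad p f x y - (egrad g y - taylor_grad q g x y)
    - (cM * p.+1%:R) *: rp y - (cN * q.+1%:R) *: rq y - egrad f y + egrad g y = - H y.
  by apply/rowP => j; rewrite /H !mxE; ring.
by rewrite dotvNl.
Qed.

End Step.

(** * Convergence *)

Lemma cluster_frequently {T : topologicalType} (x : nat -> T) z (P : set nat) (Q : set T) :
  cluster (x @ \oo) z -> (\forall k \near \oo, P k) -> (\forall v \near z, Q v) ->
  exists k, P k /\ Q (x k).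
Proof.
move=> clz nP nQ; have [v [[k Pk xk] Qv]] := clz (x @` P) Q
  (filterS (fun k Pk => ex_intro2 _ _ k Pk erefl) nP) nQ.
by exists k; rewrite xk.
Qed.

(** * Value of the objective on the cluster set, and stationarity of the limit *)

Section Limit.
Context {R : realType} {n : nat}.
Local Notation E := 'rV[R]_n.
Variables (f g : E -> R) (psi : E -> \bar R).
Hypotheses (pp : eproper psi) (lscpsi : lower_semicontinuous psi).
Let F y := f y + fine (psi y) - g y.
Variables (x w : nat -> E).
Hypothesis xD : forall k, edom psi (x k).
Hypothesis sub : forall k y, edom psi y ->
  fine (psi (x k.+1)) + dotv (w k - egrad f (x k.+1) + egrad g (x k.+1)) (y - x k.+1)
    <= fine (psi y).

Lemma near_lower_semicontinuous z (e : R) : edom psi z -> 0 < e ->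
  \forall v \near z, edom psi v -> fine (psi z) - e < fine (psi v).
Proof.
move=> Dz e0.
have : ((fine (psi z) - e)%:E < psi z)%E.
  by rewrite [ltRHS](proper_fin pp Dz) lte_fin ltrBlDr ltrDl.
move=> /lscpsi[V nV HV]; apply: filterS nV => v /HV Hv Dv.
by move: Hv; rewrite [ltRHS](proper_fin pp Dv) lte_fin.
Qed.

(** Lower semicontinuity of [psi] gives [F z <= zeta]. The reverse inequality comes from testing the
    subgradient inequality at an iterate near [z] against the point [z]. *)
Lemma cluster_value (zeta W : R) z :
  (forall k, enorm (w k) <= W) ->
  nonincreasing_seq (F \o x) -> F (x k) @[k --> \oo] --> zeta ->
  cluster (x @ \oo) z -> edom psi z ->
  {for z, continuous f} -> {for z, continuous g} ->
  {for z, continuous (egrad f)} -> {for z, continuous (egrad g)} ->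
  F z = zeta.
Proof.
move=> wW ni Fz clz Dz cf cg cdf cdg.
have zF k : zeta <= F (x k).
  have := nonincreasing_cvgn_ge ni (cvgP _ Fz) k.
  by rewrite (cvg_lim _ Fz).
apply/eqP; rewrite eq_le; apply/andP; split; apply/ler_addgt0Pr => e e0.
  have e40 : 0 < e / 4 by rewrite divr_gt0.
  have nf : \forall v \near z, f z - e / 4 < f v.
    by apply: (cvgr_gt _ cf); rewrite ltrBlDr ltrDl.
  have ng : \forall v \near z, g v < g z + e / 4.
    by apply: (cvgr_lt _ cg); rewrite ltrDl.
  have nz : \forall k \near \oo, F (x k) < zeta + e / 4.
    by apply: (cvgr_lt _ Fz); rewrite ltrDl.
  have nps := near_lower_semicontinuous Dz e40.
  have [k [Hk [H1 H2 /(_ (xD k)) H3]]] : exists k, F (x k) < zeta + e / 4 /\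
      [/\ f z - e / 4 < f (x k), g (x k) < g z + e / 4 &
        edom psi (x k) -> fine (psi z) - e / 4 < fine (psi (x k))].
    apply: (cluster_frequently (P := [set k | F (x k) < zeta + e / 4])
      (Q := [set v | [/\ f z - e / 4 < f v, g v < g z + e / 4 &
        edom psi v -> fine (psi z) - e / 4 < fine (psi v)]]) clz nz).
    by apply: filterS3 nf ng nps => v.
  by move: Hk; rewrite /F; lra.
(* An upper bound for [F v] at an iterate [v], from its subgradient inequality and Cauchy-Schwarz;
   it is continuous at [z] with value [F z]. *)
pose th v := f v - g v + fine (psi z)
  + (W + enorm (egrad f v) + enorm (egrad g v)) * enorm (z - v).
have cth : th v @[v --> z] --> F z.
  have -> : F z = f z - g z + fine (psi z)
      + (W + enorm (egrad f z) + enorm (egrad g z)) * enorm (z - z).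
    by rewrite subrr enorm0 mulr0 addr0 /F addrAC.
  have c1 : enorm (z - v) @[v --> z] --> enorm (z - z).
    apply: (@cvg_enorm R n E (nbhs z) _).
    exact: (cvgB (cvg_cst z) (@cvg_id _ (nbhs z))).
  have c2 : enorm (egrad f v) @[v --> z] --> enorm (egrad f z).
    by apply: (@cvg_enorm R n E (nbhs z) _); exact: cdf.
  have c3 : enorm (egrad g v) @[v --> z] --> enorm (egrad g z).
    by apply: (@cvg_enorm R n E (nbhs z) _); exact: cdg.
  have c4 : f v - g v + fine (psi z) @[v --> z] --> f z - g z + fine (psi z).
    exact: (cvgD (cvgB cf cg) (cvg_cst (fine (psi z)))).
  have c5 : W + enorm (egrad f v) + enorm (egrad g v) @[v --> z]
      --> W + enorm (egrad f z) + enorm (egrad g z).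
    exact: (cvgD (cvgD (cvg_cst W) c2) c3).
  exact: (cvgD c4 (cvgM c5 c1)).
have nth' : \forall v \near z, th v < F z + e.
  by apply: (cvgr_lt _ cth); rewrite ltrDl.
(* The index must be positive because subgradients are known only at [x k.+1]. *)
have [k [k0 thk]] := cluster_frequently clz (nbhs_infty_gt 0%N) nth'.
apply: le_trans (zF k) _; apply/ltW; apply: le_lt_trans thk.
case: k k0 => // k _; have := sub k Dz.
have := normr_dotv_le (w k - egrad f (x k.+1) + egrad g (x k.+1)) (z - x k.+1).
rewrite ler_norml => /andP[H1 _].
have H2 : enorm (w k - egrad f (x k.+1) + egrad g (x k.+1))
    <= W + enorm (egrad f (x k.+1)) + enorm (egrad g (x k.+1)).
  rewrite (le_trans (enormD_le _ _))// lerD2r (le_trans (enormD_le _ _))// enormN.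
  by rewrite lerD2r.
have := ler_wpM2r (enorm_ge0 (z - x k.+1)) H2.
by rewrite /F /th; lra.
Qed.

(** In the subgradient inequality the linear term converges, and [psi (x k.+1)] stands on the
    smaller side, so lower semicontinuity suffices to pass to the limit. *)
Lemma limit_stationary xs :
  x @ \oo --> xs -> edom psi xs -> w @ \oo --> (0 : E) ->
  differentiable f xs -> differentiable g xs ->
  {for xs, continuous (egrad f)} -> {for xs, continuous (egrad g)} ->
  stationary (objective f g psi) xs.
Proof.
move=> xxs Dxs w0 df dg cdf cdg; apply: frechet_limiting.
have -> : (0 : E) = (0 - egrad f xs + egrad g xs) + egrad f xs - egrad g xs.
  by apply/rowP => j; rewrite !mxE; ring.
apply: subgradient_frechet => // y Dy.
have xS : x k.+1 @[k --> \oo] --> xs by move: xxs; rewrite -cvg_shiftS.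
apply/ler_addgt0Pr => e e0.
have L : dotv (w k - egrad f (x k.+1) + egrad g (x k.+1)) (y - x k.+1) @[k --> \oo]
    --> dotv (0 - egrad f xs + egrad g xs) (y - xs).
  apply: cvg_dotv.
    exact: (cvgD (cvgB w0 (cvg_comp _ _ xS cdf)) (cvg_comp _ _ xS cdg)).
  exact: (cvgB (cvg_cst y) xS).
suff : dotv (0 - egrad f xs + egrad g xs) (y - xs) <= fine (psi y) + e - fine (psi xs).
  by lra.
apply: (cvgr_to_le L).
have nps : \forall k \near \oo, edom psi (x k.+1) ->
    fine (psi xs) - e < fine (psi (x k.+1)).
  exact: xS _ (near_lower_semicontinuous Dxs e0).
apply: filterS nps => k /(_ (xD k.+1)) H1.
by have := sub k Dy; lra.
Qed.

End Limit.

(** * Finite length from the KL inequality *)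

Section Convergence.
Context {R : realType} {n : nat}.
Local Notation E := 'rV[R]_n.

Lemma KL_summable (phi : E -> \bar R) (Fx : nat -> R) (x w : nat -> E) (a b B : R) (r : nat) :
  0 < a -> 0 <= b -> (forall k, enorm (x k) <= B) ->
  (forall k, phi (x k) = (Fx k)%:E) ->
  (forall k, a * enorm (x k.+1 - x k) ^+ r.+1 <= Fx k - Fx k.+1) ->
  (forall k, frechet_subdiff phi (x k.+1) (w k)) ->
  (forall k, enorm (w k) <= b * enorm (x k.+1 - x k) ^+ r) ->
  (forall z, cluster (x @ \oo) z -> phi z = (limn Fx)%:E) ->
  cvgn Fx -> KL_on phi (cluster (x @ \oo)) ->
  cvgn (series (fun k => enorm (x k.+1 - x k))).
Proof.
move=> a0 b0 xB phix desc fr wb phiz cF [_ _ _ [phis [phisE [delta [eps [kappa]]]]]].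
move=> [[delta0 eps0] conc [_ kappa0] dkappa KL].
have [z zOm] := bounded_cluster_nonempty xB.
have zE : limn Fx = phis by have := phiz _ zOm; rewrite (phisE _ zOm) => -[].
have ni k : Fx k.+1 <= Fx k.
  rewrite -subr_ge0 (le_trans _ (desc k))// mulr_ge0 ?exprn_ge0 ?enorm_ge0//.
  exact: ltW.
have nis : nonincreasing_seq Fx by apply/nonincreasing_seqP.
have geF k : phis <= Fx k by rewrite -zE; exact: nonincreasing_cvgn_ge.
pose d k := enorm (x k.+1 - x k).
have d0 k : 0 <= d k by exact: enorm_ge0.
(* If the limit value is attained, descent makes all later steps zero; the KL inequality requires
   values strictly above it. *)
have [[N FN]|Fgt] := pselect (exists N, Fx N <= phis).
  have dk0 k : (N <= k)%N -> d k = 0.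
    move=> Nk; apply/eqP; rewrite eq_le d0 andbT leNgt; apply/negP => dk.
    have := desc k; rewrite leNgt => /negP; apply.
    apply: (@le_lt_trans _ _ 0); last by rewrite mulr_gt0 ?exprn_gt0.
    by rewrite subr_le0 (le_trans (nis _ _ Nk))// (le_trans FN).
  apply: (@summable_of_contraction R d (fun=> 0) 0 N) => // k Nk.
  rewrite subrr mulr0 addr0 dk0 ?(leq_trans Nk)//.
  by rewrite divr_ge0.
have {}Fgt k : phis < Fx k.
  by rewrite ltNge; apply/negP => H; apply: Fgt; exists k.
have [N _ HN] : \forall k \near \oo, Fx k < phis + eps /\
    (edist_set (x k) (cluster (x @ \oo)) <= delta%:E)%E.
  have n1 : \forall k \near \oo, Fx k < phis + eps.
    have cF' : Fx @ \oo --> phis by rewrite -zE.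
    by apply: (cvgr_lt _ cF'); rewrite ltrDl.
  exact: filterS2 n1 (near_edist_cluster xB delta0) => k.
(* The shift matches the subgradient at [x k.+1], which is bounded by the preceding step [d k]. *)
pose K k := kappa (Fx k.+1 - phis).
have inN k : (N <= k)%N -> 0 < Fx k - phis < eps.
  by move=> /HN[H _]; rewrite subr_gt0 Fgt/= ltrBlDl.
apply: (@summable_of_contraction R d K (b * 2 ^+ r / a) N) => //.
- by rewrite divr_ge0 ?mulr_ge0 ?exprn_ge0// ltW.
- move=> k Nk; apply: kappa0.
  by have /andP[/ltW -> /ltW ->] := inN _ (leqW Nk).
move=> k Nk; have Nk1 := leqW Nk; have Nk2 := leqW Nk1.
have [Hdom Hdist] := HN _ Nk1.
have /andP[s0 se] := inN _ Nk1; have /andP[t0 te] := inN _ Nk2.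
have sin : 0 < Fx k.+1 - phis < eps by rewrite s0.
have tin : 0 <= Fx k.+2 - phis <= eps by rewrite !ltW.
have [dks dks0] := dkappa _ sin.
have KLk : 1 <= derive1 kappa (Fx k.+1 - phis) * (b * d k ^+ r).
  have := KL (x k.+1) Hdist; rewrite phix !lte_fin /= => /(_ (Fgt _) Hdom) H.
  rewrite -lee_fin (le_trans H)// EFinM lee_pmul2l// ?lte_fin//.
  by rewrite (le_trans (slope_le (fr k)))// lee_fin.
have tan := concave_tangent conc sin tin dks.
have E : Fx k.+1 - phis - (Fx k.+2 - phis) = Fx k.+1 - Fx k.+2 by ring.
rewrite E in tan.
have De0 : 0 <= Fx k.+1 - Fx k.+2 by rewrite subr_ge0.
have dr0 : 0 <= b * d k ^+ r by rewrite mulr_ge0 ?exprn_ge0.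
have DK0 : 0 <= K k - K k.+1 by rewrite (le_trans _ tan)// mulr_ge0// ltW.
apply: contraction_alternative => //.
rewrite (le_trans (desc k.+1))//.
(* The decrease of $F$ is multiplied by the KL bound, which is at least 1; the tangent inequality
   then turns $\kappa'$ times the decrease into [K k - K k.+1]. *)
rewrite -[leLHS]mulr1 (le_trans (ler_wpM2l De0 KLk))//.
have := ler_wpM2r dr0 tan; rewrite /K; move: (derive1 kappa _) => c.
move: (kappa _) (kappa _) (Fx k.+1 - _) (d k ^+ r) => k2 k1 D dr H.
have -> : D * (c * (b * dr)) = c * D * (b * dr) by ring.
by have -> : b * (k1 - k2) * dr = (k1 - k2) * (b * dr) by ring.
Qed.

End Convergence.

Theorem theorem4 (R : realType) (n p q : nat) (hp : (0 < p)%N) (hq : (0 < q)%N)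
  (f g : 'rV[R]_n -> R) (psi : 'rV[R]_n -> \bar R) (Lf Lg : R)
  (A1 : smooth_convex p Lf (edom psi) f)
  (A2 : smooth_convex q Lg (edom psi) g)
  (A3 : [/\ eproper psi, lower_semicontinuous psi, econvex psi,
            closed (edom psi) & convex_set (edom psi)])
  (A4 : exists2 xs, edom psi xs &
          forall y, (objective f g psi xs <= objective f g psi y)%E)
  (x : nat -> 'rV[R]_n)
  (hx : HO_DC p q Lf Lg f g psi x)
  (hbnd : exists B : R, forall k, enorm (x k) <= B)
  (hKL : KL_on (objective f g psi) (cluster (x @ \oo))) :
  exists xs : 'rV[R]_n,
    x @ \oo --> xs /\ stationary (objective f g psi) xs.
Proof.
have [pp lsc cp cl cD] := A3.
have [fdiff _ _ _] := smooth_convex_model hp cD A1.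
have [gdiff _ _ _] := smooth_convex_model hq cD A2.
have [Mp [Mq [LMp LMq D0 step]]] := hx.
have [B xB] := hbnd.
have B0 : 0 <= B by apply: le_trans (xB 0%N); exact: enorm_ge0.
(* By the triangle inequality [2 * B] bounds every step, so one pair of constants serves all
   iterations. *)
have [a [b [a0 b0 HS]]] := HO_DC_step (2 * B) hp hq A1 A2 pp cp cD LMp LMq.
have dB k : enorm (x k.+1 - x k) <= 2 * B.
  rewrite (le_trans (enormD_le _ _))// enormN.
  by have := xB k; have := xB k.+1; lra.
have xD k : edom psi (x k).
  elim: k => [//|k IH]; have [st le] := step k.
  by have [] := HS _ _ IH (dB k) st le.
have HSk k : exists w : 'rV[R]_n,
    [/\ a * enorm (x k.+1 - x k) ^+ (minn p q).+1 <=
        (f (x k) + fine (psi (x k)) - g (x k))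
        - (f (x k.+1) + fine (psi (x k.+1)) - g (x k.+1)),
      enorm w <= b * enorm (x k.+1 - x k) ^+ minn p q &
      forall z, edom psi z -> fine (psi (x k.+1)) +
        dotv (w - egrad f (x k.+1) + egrad g (x k.+1)) (z - x k.+1) <= fine (psi z)].
  have [st le] := step k.
  by have [_ desc [w wb sub]] := HS _ _ (xD k) (dB k) st le; exists w.
have [w Hw] := choice HSk.
pose F y := f y + fine (psi y) - g y.
have desc k : a * enorm (x k.+1 - x k) ^+ (minn p q).+1 <= F (x k) - F (x k.+1).
  by have [] := Hw k.
have wb k : enorm (w k) <= b * enorm (x k.+1 - x k) ^+ minn p q by have [] := Hw k.
have sub k := let: And3 _ _ s := Hw k in s.
have ni : nonincreasing_seq (F \o x).
  apply/nonincreasing_seqP => k; rewrite -subr_ge0 (le_trans _ (desc k))//.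
  by rewrite mulr_ge0 ?exprn_ge0 ?enorm_ge0// ltW.
have [xm Dxm xmin] := A4.
have cF : cvgn (F \o x).
  apply: nonincreasing_is_cvgn => //; exists (F xm) => _ [k _ <-].
  have := xmin (x k); rewrite (objective_fin f g pp Dxm) (objective_fin f g pp (xD k)).
  by rewrite lee_fin.
have clD z : cluster (x @ \oo) z -> edom psi z.
  have [_ _ sD _] := hKL; move=> /sD; rewrite /edom/= /objective.
  by have := pp.1 z; case: (psi z) => [r _ _|_|//]; first exact: ltry.
have clF z : cluster (x @ \oo) z ->
    objective f g psi z = (limn (F \o x))%:E.
  move=> clz; have Dz := clD z clz; rewrite (objective_fin f g pp Dz); congr EFin.
  have [fz dfz] := fdiff z Dz; have [gz dgz] := gdiff z Dz.
  apply: (cluster_value (W := b * (2 * B) ^+ minn p q) pp lsc xD sub _ ni cF clz Dz _ _ dfz dgz).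
  - move=> k; rewrite (le_trans (wb k))// ler_wpM2l// lerXn2r ?nnegrE ?enorm_ge0//.
    by rewrite mulr_ge0.
  - exact: differentiable_continuous.
  - exact: differentiable_continuous.
have fr k : frechet_subdiff (objective f g psi) (x k.+1) (w k).
  have [fz _] := fdiff _ (xD k.+1); have [gz _] := gdiff _ (xD k.+1).
  have := subgradient_frechet pp (xD k.+1) fz gz (sub k).
  by congr frechet_subdiff; apply/rowP => j; rewrite !mxE; ring.
have summ : cvgn (series (fun k => enorm (x k.+1 - x k))).
  apply: (KL_summable (phi := objective f g psi) (Fx := F \o x) a0 b0 xB _ desc fr wb clF cF hKL).
  by move=> k; exact: objective_fin.
have cx := cvg_of_summable_steps summ.
exists (limn x); split; first exact: cx.
have Dxs : edom psi (limn x).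
  exact: (@closed_cvg _ _ _ eventually_filter x (edom psi) cl (nearW _ xD) _ cx).
have [fz dfz] := fdiff _ Dxs; have [gz dgz] := gdiff _ Dxs.
apply: (limit_stationary pp lsc xD sub cx Dxs _ fz gz dfz dgz).
have dk0 := cvg_series_cvg_0 summ.
(* Summable steps tend to 0, and since [minn p q] is positive the bound on the subgradients does
   too. *)
have bd0 : b * enorm (x k.+1 - x k) ^+ minn p q @[k --> \oo] --> (0 : R).
  have : b * enorm (x k.+1 - x k) ^+ minn p q @[k --> \oo] --> b * 0 ^+ minn p q.
    apply: cvgM; first exact: cvg_cst.
    exact: (cvg_comp _ _ dk0 (@exprn_continuous R (minn p q) 0)).
  by rewrite expr0n gtn_eqF ?mulr0// leq_min hp hq.
apply/cvgrPdist_lt => e e0.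
have nbd : \forall k \near \oo, b * enorm (x k.+1 - x k) ^+ minn p q < e.
  exact: (cvgr_lt _ bd0).
apply: filterS nbd => k.
rewrite sub0r normrN; apply: le_lt_trans.
by rewrite (le_trans (normr_le_enorm _))//; exact: wb.
Qed.
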